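(* In the setting described in the context (discrete or continuous case), let $L$ be invertible and assume $s_X<\infty$, or either $L$ or $L^{-1}$ is bounded. If $y=K^Yg$ for some $g\in S$, then $$\|y-L\Pi_r^XL^{-1}y\|_Y\le\sum_{k>r}\sigma_k\,|(g,f_k)_S|\,\|L\varphi_k\|_Y$$ and the error converges to zero as $r$ increases. Now assume in addition that $\{L\Pi_r^XL^{-1}\}$ is uniformly bounded in operator norm whenever $s_X=\infty$. If the POD eigenvalues for the data $\{Lw_j\}$ are all nonzero, then $L\Pi_r^XL^{-1}y\to y$ for all $y\in Y$.
   Context: Scalars are $\mathbb{K}=\mathbb{R}$ or $\mathbb{C}$; inner products are linear in the first argument. $X,Y$ are separable Hilbert spaces and $L:\mathcal{D}(L)\subset X\to Y$ is a linear operator, possibly unbounded. A ''bounded'' operator is by convention defined on the whole space. ''Invertible'' means injective, with $L^{-1}:\mathcal{D}(L^{-1})=\mathcal{R}(L)\subset Y\to X$; thus ''$L^{-1}$ bounded'' means $\mathcal{R}(L)=Y$ and $L^{-1}:Y\to X$ is bounded. Discrete case: $s\ge1$, weights $\gamma_1,\dots,\gamma_s>0$, $S=\mathbb{K}^s$ with $(u,v)_S=\sum_{j=1}^s\gamma_ju_j\overline{v_j}$, data $\{w_j\}_{j=1}^s\subset\mathcal{D}(L)$, and POD operator $K:S\to X$, $Kf=\sum_{j=1}^s\gamma_jf_jw_j$. Continuous case: $\mathcal{O}\subset\mathbb{R}^d$ open, $m\ge1$, $S=L^2(\mathcal{O};\mathbb{K}^m)$, data $\{w_j\}_{j=1}^m\subset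 L^2(\mathcal{O};X)$, POD operator $K:S\to X$, $Kf=\sum_{j=1}^m\int_{\mathcal{O}}f_j(t)w_j(t)\,dt$; it is assumed that $w_j(t)\in\mathcal{D}(L)$ a.e., $Lw_j\in L^2(\mathcal{O};Y)$, and for all $f\in S$, $Kf\in\mathcal{D}(L)$ and $LKf=\sum_{j=1}^m\int_{\mathcal{O}}f_j(t)Lw_j(t)\,dt$. In both cases $K$ is compact with singular value decomposition $Kf=\sum_{k\ge1}\sigma_k(f,f_k)_S\varphi_k$, $\sigma_1\ge\sigma_2\ge\dots\ge0$, with orthonormal singular vectors $\{f_k\}\subset S$, $\{\varphi_k\}\subset X$. $s_X=\mathrm{rank}(K)\in\mathbb{N}\cup\{\infty\}$, so $\sigma_k>0$ exactly for $k\le s_X$, and then $\varphi_k=\sigma_k^{-1}Kf_k\in\mathcal{D}(L)$. $K^Y=LK:S\to Y$ is the (compact) POD operator for the data $\{Lw_j\}$; the POD eigenvalues for $\{Lw_j\}$ are the eigenvalues of $K^Y(K^Y)^*:Y\to Y$. In sums over $k>r$, terms with $\sigma_k=0$ are taken to be zero. For each positive integer $r$ with $\sigma_r>0$: $X_r=\mathrm{span}\{\varphi_k\}_{k=1}^r\subset\mathcal{D}(L)$ and $\Pi_r^X:X\to X$ is the orthogonal projection onto $X_r$. The operator $L\Pi_r^XL^{-1}$ is initially defined on $\mathcal{D}(L^{-1})$; the family $\{L\Pi_r^XL^{-1}\}$ is uniformly bounded in operator norm if each member extends to a bounded linear operator on $Y$ (denoted by the same symbol) with norm at most $C$, $C$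 independent of $r$. ''As $r$ increases'' means $r=1,2,\dots$ with $r\le s_X$: if $s_X=\infty$ it is the limit $r\to\infty$; if $s_X<\infty$, convergence to a limit means that the limit is attained at $r=s_X$. *)

(* Defs.v *)
From HB Require Import structures.
From mathcomp Require Import all_boot all_order all_algebra sesquilinear complex.
From mathcomp Require Import all_classical all_reals all_analysis.

Set Implicit Arguments.
Unset Strict Implicit.
Unset Printing Implicit Defensive.

Import Order.TTheory GRing.Theory Num.Theory numFieldNormedType.Exports.

Local Open Scope classical_set_scope.
Local Open Scope ring_scope.

Variant scalar_kind := RealScalars | ComplexScalars.

Definition scalar_field (R : realType) (c : scalar_kind) : numFieldType :=
  match c with RealScalars => R | ComplexScalars => R[i] end.

Definition sconj (R : realType) (c : scalar_kind) :
    scalar_field R c -> scalar_field R c :=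
  match c return scalar_field R c -> scalar_field R c with
  | RealScalars => fun z => z
  | ComplexScalars => fun z : R[i] => Num.conj z
  end.

Definition sRe (R : realType) (c : scalar_kind) : scalar_field R c -> R :=
  match c return scalar_field R c -> R with
  | RealScalars => fun z => z
  | ComplexScalars => fun z : R[i] => complex.Re z
  end.

Definition sreal (R : realType) (c : scalar_kind) : R -> scalar_field R c :=
  match c return R -> scalar_field R c with
  | RealScalars => fun x => x
  | ComplexScalars => fun x => (x%:C)%C
  end.

(* The library norm of a normed module over K takes its values in K; [rnorm]
   is the same norm with values in R. *)
Definition rnorm (R : realType) (c : scalar_kind)
    (V : normedModType (scalar_field R c)) (v : V) : R := sRe `|v|.

Definition separable (T : topologicalType) :=
  exists A : set T, countable A /\ dense A.

(* A separable Hilbert space over K. Dot products of the library are linear in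
   the first argument and [sconj]-linear in the second one. *)
Record hilbertSpace (R : realType) (c : scalar_kind) := HilbertSpace {
  hcarrier :> completeNormedModType (scalar_field R c) ;
  hdot : {dot hcarrier for @sconj R c} ;
  hdot_norm : forall x : hcarrier, `|x| ^+ 2 = hdot x x ;
  hseparable : separable hcarrier }.

Section PartialOperators.
Context (R : realType) (c : scalar_kind).
Local Notation K := (scalar_field R c).

(* The values of [ap A] outside of [dom A] are irrelevant. *)
Record partial_op (X Y : Type) := PartialOp { dom : set X ; ap : X -> Y }.

Definition pop_total (X Y : Type) (f : X -> Y) : partial_op X Y :=
  PartialOp setT f.

Definition pop_comp (X Y Z : Type) (B : partial_op Y Z) (A : partial_op X Y) :
    partial_op X Z :=
  PartialOp [set x | dom A x /\ dom B (ap A x)] (fun x => ap B (ap A x)).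

Definition linear_op (X Y : lmodType K) (A : partial_op X Y) :=
  dom A 0 /\
  forall (a : K) (x y : X), dom A x -> dom A y ->
    dom A (a *: x + y) /\ ap A (a *: x + y) = a *: ap A x + ap A y.

Definition injective_op (X Y : Type) (A : partial_op X Y) :=
  forall x y, dom A x -> dom A y -> ap A x = ap A y -> x = y.

Definition pop_inv (X : pointedType) (Y : Type) (A : partial_op X Y) :
    partial_op Y X :=
  PartialOp (ap A @` dom A) (fun y => xget point [set x | dom A x /\ ap A x = y]).

Definition bounded_op (X Y : normedModType K) (A : partial_op X Y) :=
  dom A = setT /\ exists C : R, forall x, rnorm (ap A x) <= C * rnorm x.

Definition extends_op (X Y : Type) (T : X -> Y) (A : partial_op X Y) :=
  forall x, dom A x -> T x = ap A x.

End PartialOperators.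

Section Subspaces.
Context (R : realType) (c : scalar_kind).
Local Notation K := (scalar_field R c).

Definition spanned (X : lmodType K) (n : nat) (b : 'I_n -> X) : set X :=
  [set x | exists a : 'I_n -> K, x = \sum_(i < n) a i *: b i].

Definition lin_indep (X : lmodType K) (n : nat) (b : 'I_n -> X) :=
  forall a : 'I_n -> K, \sum_(i < n) a i *: b i = 0 -> forall i, a i = 0.

Definition has_dim (X : lmodType K) (E : set X) (n : nat) :=
  exists b : 'I_n -> X, lin_indep b /\ E = spanned b.

(* [None] stands for an infinite dimension. *)
Definition is_dim (X : lmodType K) (E : set X) (s : option nat) :=
  match s with
  | Some n => has_dim E n
  | None => forall n, ~ has_dim E n
  end.

Definition orth_proj (X : hilbertSpace R c) (E : set X) (x : X) : X :=
  xget 0 [set p | E p /\ forall v, E v -> hdot X (x - p) v = 0].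

End Subspaces.

Section BochnerIntegral.
Context (R : realType) (c : scalar_kind) (disp : measure_display).
Local Notation K := (scalar_field R c).
Context (T : measurableType disp) (mu : {measure set T -> \bar R}) (D : set T).
Context (V : normedModType K).

Record mu_simple := MuSimple {
  ms_size : nat ;
  ms_set : 'I_ms_size -> set T ;
  ms_val : 'I_ms_size -> V ;
  ms_measurable : forall i, measurable (ms_set i) ;
  ms_sub : forall i, ms_set i `<=` D ;
  ms_finite : forall i, (mu (ms_set i) < +oo)%E }.

Definition ms_fun (s : mu_simple) (t : T) : V :=
  \sum_(i < ms_size s) (\1_(ms_set i) t : K) *: ms_val i.

Definition ms_integral (s : mu_simple) : V :=
  \sum_(i < ms_size s) sreal c (fine (mu (ms_set i))) *: ms_val i.

Definition strongly_measurable (f : T -> V) :=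
  exists s : nat -> mu_simple,
    {ae mu, forall t, D t -> (fun n => ms_fun (s n) t) @ \oo --> f t}.

Definition is_bochner (f : T -> V) (v : V) :=
  strongly_measurable f /\
  exists s : nat -> mu_simple,
    (fun n => \int[mu]_(t in D) (rnorm (f t - ms_fun (s n) t))%:E)%E
      @ \oo --> (0 : \bar R) /\
    (fun n => ms_integral (s n)) @ \oo --> v.

(* The Bochner integral of f over D with respect to mu, and 0 if f is not
   Bochner integrable. *)
Definition bochner (f : T -> V) : V := xget 0 [set v | is_bochner f v].

Definition in_L2 (f : T -> V) :=
  strongly_measurable f /\
  (\int[mu]_(t in D) ((rnorm (f t)) ^+ 2)%:E < +oo)%E.

End BochnerIntegral.

Section LebesgueMeasure.
Context (R : realType) (d : nat).
Local Open Scope ereal_scope.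

(* R^(d+1), so that the dimension is positive. *)
Local Notation E := 'rV[R]_d.+1.

Definition box (ab : E * E) : set E :=
  [set x | forall i, (ab.1 ord0 i < x ord0 i <= ab.2 ord0 i)%R].

Definition box_volume (ab : E * E) : R :=
  (\prod_(i < d.+1) Num.max 0 (ab.2 ord0 i - ab.1 ord0 i))%R.

Definition lebesgue_outer (A : set E) : \bar R :=
  ereal_inf [set \sum_(k <oo) (box_volume (B k))%:E |
             B in [set B : nat -> E * E | A `<=` \bigcup_k box (B k)]].

Let box_volume_ge0 ab : 0 <= (box_volume ab)%:E.
Proof.
by rewrite lee_fin; apply: prodr_ge0 => i _; rewrite le_max lexx.
Qed.

Let lebesgue_outer_ge0 A : 0 <= lebesgue_outer A.
Proof.
by apply: le_ereal_inf_tmp => x [B _ <-{x}]; exact: nneseries_ge0.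
Qed.

Let lebesgue_outer_le A B : A `<=` B -> lebesgue_outer A <= lebesgue_outer B.
Proof.
move=> AB; apply/ereal_inf_le_tmp => x [F BF <-{x}].
by exists F => //; exact: subset_trans AB BF.
Qed.

Let lebesgue_outer0 : lebesgue_outer set0 = 0.
Proof.
apply/eqP; rewrite eq_le lebesgue_outer_ge0 andbT.
apply: ereal_inf_lbound; exists (fun=> (0%R, 0%R)); first exact: sub0set.
rewrite eseries0// => i _ _; rewrite /box_volume big_ord_recl/=.
by rewrite subrr maxxx mul0r.
Qed.

Let lebesgue_outer_sigma_subadditive : sigma_subadditive lebesgue_outer.
Proof.
move=> A; have [[i ioo]|] := pselect (exists i, lebesgue_outer (A i) = +oo).
  rewrite (eseries_pinfty _ _ ioo) ?leey// => n _.
  by rewrite -ltNye (lt_le_trans _ (lebesgue_outer_ge0 _)).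
rewrite -forallNE => Aoo.
suff add2e (e : {posnum R}) :
    lebesgue_outer (\bigcup_n A n) <=
    \sum_(i <oo) lebesgue_outer (A i) + e%:num%:E.
  by apply/lee_addgt0Pr => _/posnumP[].
rewrite (le_trans _ (epsilon_trick _ _ _))//.
pose P n (B : nat -> E * E) := A n `<=` \bigcup_k box (B k) /\
  \sum_(k <oo) (box_volume (B k))%:E <=
  lebesgue_outer (A n) + (e%:num / (2 ^ n.+1)%:R)%:E.
have [G PG] : {G : nat -> nat -> E * E & forall n, P n (G n)}.
  apply: (@choice _ _ P) => n; rewrite /P /lebesgue_outer.
  set S := (X in ereal_inf X); move infS : (ereal_inf S) => iS.
  case: iS infS => [r Sr|Soo|Soo].
  - have en1 : (0 < e%:num / (2 ^ n.+1)%:R)%R by [].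
    have /(lb_ereal_inf_adherent en1) : ereal_inf S \is a fin_num by rewrite Sr.
    move=> [x [B AnB muBx] xS].
    by exists B; split => //; rewrite muBx -Sr; exact/ltW.
  - by have := Aoo n; rewrite /lebesgue_outer Soo.
  - suff : lbound S 0 by move/le_ereal_inf_tmp; rewrite Soo.
    by move=> /= _ [B AnB <-]; exact: nneseries_ge0.
pose v (p : nat * nat) : \bar R := (box_volume (G p.1 p.2))%:E.
have v_ge0 p : 0 <= v p by exact: box_volume_ge0.
apply: (@le_trans _ _ (\esum_(i in setT) v i)).
  apply: ereal_inf_lbound => /=.
  have /card_esym/ppcard_eqP[f] := card_nat2.
  exists (fun k => G (f k).1 (f k).2).
    move=> t [i _ /(PG i).1[j _ Bijt]]; exists (f^-1%FUN (i, j)) => //=.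
    by rewrite invK ?inE.
  rewrite -(esum_pred_image v f xpredT) ?[fun=> _]set_true//.
  by rewrite image_eq.
rewrite (_ : esum _ _ = \sum_(i <oo) \sum_(j <oo) v (i, j)); last first.
  pose J : nat -> set (nat * nat) := fun i => [set (i, j) | j in setT].
  rewrite (_ : setT = \bigcup_k J k); last first.
    by rewrite predeqE => -[a b]; split => // _; exists a => //; exists b.
  rewrite esum_bigcupT /=; last 2 first.
    - apply/trivIsetP => i j _ _ ij.
      rewrite predeqE => -[n m] /=; split => //= -[] [_] _ [<-{n} _].
      by move=> [m' _] [] /esym/eqP; rewrite (negbTE ij).
    - by move=> /= p; exact: v_ge0.
  rewrite -(image_id [set: nat]) -fun_true esum_pred_image//; last first.
    by move=> n _; exact: esum_ge0.
  apply: eq_eseriesr => /= j _.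
  rewrite -(esum_pred_image v (pair j) predT)//=; last first.
    by move=> ? ? _ _; exact: (@can_inj _ _ _ snd).
  by congr esum; rewrite predeqE => -[a b]; split; move=> [i _ <-]; exists i.
apply: lee_lim.
- by apply: is_cvg_nneseries => n *; exact: nneseries_ge0.
- by apply: is_cvg_nneseries => n *; exact: adde_ge0.
- by near=> n; apply: lee_sum => i _; exact: (PG i).2.
Unshelve. all: by end_near. Qed.

HB.instance Definition _ := isOuterMeasure.Build R E lebesgue_outer
  lebesgue_outer0 lebesgue_outer_ge0 lebesgue_outer_le
  lebesgue_outer_sigma_subadditive.

(* R^(d+1) with the Lebesgue measurable sets, and the Lebesgue measure on it:
   the restriction of the outer measure, by the Caratheodory theorem. *)
Definition lebesgue_outer_measure : {outer_measure set E -> \bar R} :=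
  lebesgue_outer.

Definition lebesgue_space : measurableType lebesgue_outer_measure.-cara :=
  caratheodory_type lebesgue_outer_measure.

Definition lebesgue_meas : {measure set lebesgue_space -> \bar R} :=
  (lebesgue_outer_measure : set (caratheodory_type lebesgue_outer_measure) -> \bar R).

End LebesgueMeasure.

Section POD.
Context (R : realType) (c : scalar_kind).
Local Notation K := (scalar_field R c).

(* The space S of the coefficients, presented by the functions that represent
   its elements (in the continuous case two functions that agree almost
   everywhere represent the same element of S), with its inner product. *)
Record data_space := DataSpace {
  ds_fun :> Type ;
  ds_mem : set ds_fun ;
  ds_dot : ds_fun -> ds_fun -> K }.

Definition discrete_space (s : nat) (gamma : 'I_s -> R) : data_space :=
  DataSpace [set: 'I_s -> K]
    (fun u v => \sum_(j < s) sreal c (gamma j) * u j * sconj (v j)).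

Definition discrete_pod (X : lmodType K) (s : nat) (gamma : 'I_s -> R)
    (w : 'I_s -> X) (f : 'I_s -> K) : X :=
  \sum_(j < s) (sreal c (gamma j) * f j) *: w j.

Definition continuous_space (d m : nat) (O : set 'rV[R]_d.+1) : data_space :=
  DataSpace
    [set f : 'I_m -> lebesgue_space R d -> K |
       forall j, in_L2 (lebesgue_meas R d) O (f j : _ -> K^o)]
    (fun f g => bochner (lebesgue_meas R d) O
       (fun t => \sum_(j < m) f j t * sconj (g j t) : K^o)).

Definition continuous_pod (X : normedModType K) (d m : nat)
    (O : set 'rV[R]_d.+1) (w : 'I_m -> lebesgue_space R d -> X)
    (f : 'I_m -> lebesgue_space R d -> K) : X :=
  \sum_(j < m) bochner (lebesgue_meas R d) O (fun t => f j t *: w j t).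

(* [pod_setting L S P]: P : S -> X is the POD operator for data that satisfy
   the requirements of the discrete or of the continuous case. *)
Variant pod_setting (X Y : hilbertSpace R c) (L : partial_op X Y) :
    forall S : data_space, (S -> X) -> Prop :=
| PodDiscrete (s : nat) (gamma : 'I_s -> R) (w : 'I_s -> X) of
    (0 < s)%N & (forall j, 0 < gamma j) & (forall j, dom L (w j)) :
    @pod_setting X Y L (discrete_space gamma) (discrete_pod gamma w)
| PodContinuous (d m : nat) (O : set 'rV[R]_d.+1)
    (w : 'I_m -> lebesgue_space R d -> X) of
    (0 < m)%N & open O &
    (forall j, in_L2 (lebesgue_meas R d) O (w j)) &
    (forall j, {ae lebesgue_meas R d, forall t, O t -> dom L (w j t)}) &
    (forall j, in_L2 (lebesgue_meas R d) O (fun t => ap L (w j t))) &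
    (forall f, ds_mem (d := continuous_space m O) f ->
       dom L (continuous_pod O w f) /\
       ap L (continuous_pod O w f) =
         continuous_pod O (fun j t => ap L (w j t)) f) :
    @pod_setting X Y L (continuous_space m O) (continuous_pod O w).

(* Indices start at 0: [sigma k], [f k], [phi k] are the (k+1)-st singular value
   and singular vectors. Only the singular vectors with a nonzero singular value
   matter, so that finite decompositions are padded with zero singular values
   and arbitrary vectors. *)
Definition is_svd (S : data_space) (X : hilbertSpace R c) (P : S -> X)
    (sigma : nat -> R) (f : nat -> S) (phi : nat -> X) :=
  [/\ (forall k, 0 <= sigma k) /\ nonincreasing_seq sigma,
      forall k, 0 < sigma k -> ds_mem (f k),
      forall j k, 0 < sigma j -> 0 < sigma k -> ds_dot (f j) (f k) = (j == k)%:R,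
      forall j k, 0 < sigma j -> 0 < sigma k -> hdot X (phi j) (phi k) = (j == k)%:R
    & forall g, ds_mem g ->
        (fun n => \sum_(k < n) (sreal c (sigma k) * ds_dot g (f k)) *: phi k)
          @ \oo --> P g].

(* The operator L Pi_r L^-1, with Pi_r the orthogonal projection onto the span
   of the first r singular vectors of X. *)
Definition proj_op (X Y : hilbertSpace R c) (L : partial_op X Y)
    (phi : nat -> X) (r : nat) : partial_op Y Y :=
  pop_comp L (pop_comp
    (pop_total (orth_proj (spanned (fun k : 'I_r => phi k)))) (pop_inv L)).

(* [lambda] is an eigenvalue of A A^*: the element h is A^* v. *)
Definition eigenvalue_AAadj (S : data_space) (Y : hilbertSpace R c) (A : S -> Y)
    (lambda : K) :=
  exists (v : Y) (h : S), [/\ v != 0, ds_mem h,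
    forall f, ds_mem f -> hdot Y (A f) v = ds_dot f h & A h = lambda *: v].

Definition cvg_upto (Y : topologicalType) (s : option nat) (u : nat -> Y)
    (y : Y) :=
  match s with
  | Some n => u n = y
  | None => u @ \oo --> y
  end.

End POD.

(* Main.v *)
Require Import Defs.
From HB Require Import structures.
From mathcomp Require Import all_boot all_order all_algebra sesquilinear complex.
From mathcomp Require Import all_classical all_reals all_analysis.
From mathcomp Require Import measurable_realfun lra.

Set Implicit Arguments.
Unset Strict Implicit.
Unset Printing Implicit Defensive.

Import Order.TTheory GRing.Theory Num.Theory numFieldNormedType.Exports.

Local Open Scope classical_set_scope.
Local Open Scope ring_scope.

(** Write c k = sigma k <g, f k>. The projection of P g onto the span of
    phi 0, ..., phi (r - 1) is the partial sum of the singular value expansion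
    of P g, so that L Pi_r L^-1 maps L P g to the r-th partial sum of the series
    of the c k L phi k. Both assertions about y = L P g thus say that this series
    converges to L P g, which is clear when the rank is finite. Otherwise, let
    g n be g minus its components along f 0, ..., f (n - 1). By Bessel's
    inequality the g n form a Cauchy sequence in S. The operator L P is bounded
    on S, because it is the POD operator of the data L w; hence the L P (g n) form
    a Cauchy sequence in Y and converge. As P (g n) tends to 0 and L is closed
    (this is where L or L^-1 is bounded), the limit is 0; this is
    [pod_image_cvg].

    A vector orthogonal to the range of L P lies in the kernel of (L P)^*, and
    would be an eigenvector for the eigenvalue 0; hence the vectors L phi k span
    a dense subspace of Y, and all of Y if the rank is finite. The operator
    L Pi_r L^-1 fixes L phi k for k < r, and the uniform bound extends the
    convergence from the span to Y ([projection_total]).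

    The facts about S and P that are used are collected in [pod_structure]: S
    carries a positive semidefinite Hermitian form for which L P is bounded. In
    the continuous setting they require the theory of the Bochner integral of
    strongly measurable functions. It is developed weakly: for every bounded real
    functional l, the value of l at the integral of F is the Lebesgue integral of
    l F ([is_bochner_functional]), and in a Hilbert space or in the field of
    scalars the functionals determine a vector and its norm ([norming]).
    Linearity, the norm inequality and the compatibility with conjugation are
    then inherited from the Lebesgue integral. Existence of the integral follows
    from completeness, by approximation with truncated simple functions
    ([simple_approximation]). *)

(** * Scalars and real-valued norms *)

Section Scalars.
Context (R : realType) (c : scalar_kind).
Local Notation K := (scalar_field R c).

Lemma sreal_zmod : zmod_morphism (@sreal R c).
Proof. by case: c => //= x y; rewrite rmorphB. Qed.

Lemma sreal_monoid : monoid_morphism (@sreal R c).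
Proof. by case: c; split=> //= x y; rewrite rmorphM. Qed.

Lemma sconj_zmod : zmod_morphism (@sconj R c).
Proof. by case: c => //= x y; rewrite rmorphB. Qed.

Lemma sconj_monoid : monoid_morphism (@sconj R c).
Proof. by case: c; split=> //= [|x y]; rewrite ?rmorph1 ?rmorphM. Qed.

Lemma sRe_zmod : zmod_morphism (@sRe R c).
Proof. by case: c => //= x y; rewrite raddfB. Qed.

HB.instance Definition _ := GRing.isZmodMorphism.Build R K (@sreal R c) sreal_zmod.
HB.instance Definition _ := GRing.isMonoidMorphism.Build R K (@sreal R c) sreal_monoid.
HB.instance Definition _ := GRing.isZmodMorphism.Build K K (@sconj R c) sconj_zmod.
HB.instance Definition _ := GRing.isMonoidMorphism.Build K K (@sconj R c) sconj_monoid.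
HB.instance Definition _ := GRing.isZmodMorphism.Build K R (@sRe R c) sRe_zmod.

Lemma srealK : cancel (@sreal R c) (@sRe R c).
Proof. by case: c. Qed.

Lemma sreal_inj : injective (@sreal R c).
Proof. exact: can_inj srealK. Qed.

Lemma ler_sreal : {mono @sreal R c : x y / x <= y}.
Proof. by case: c => //= x y; rewrite lecR. Qed.

Lemma ltr_sreal : {mono @sreal R c : x y / x < y}.
Proof. by case: c => //= x y; rewrite ltcR. Qed.

Lemma sreal_eq0 (x : R) : (@sreal R c x == 0) = (x == 0).
Proof. by rewrite -(inj_eq sreal_inj) rmorph0. Qed.

Lemma sReK (a : K) : 0 <= a -> @sreal R c (sRe a) = a.
Proof.
by case: c a => [a _|[x y]] //=; rewrite lecE /= => /andP[/eqP-> _].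
Qed.

Lemma sReM (x : R) (a : K) : sRe (sreal c x * a) = x * sRe a.
Proof. by case: c a => //= -[a b]; rewrite /= mul0r subr0. Qed.

Lemma sconjK : involutive (@sconj R c).
Proof. by case: c => //= a; rewrite conjCK. Qed.

Lemma sconj_sreal (x : R) : sconj (sreal c x) = sreal c x.
Proof. by case: c => //=; apply/eqP; rewrite eq_complex /= oppr0 !eqxx. Qed.

Lemma sconj_fixed (a : K) : sconj a = a -> a = sreal c (sRe a).
Proof.
case: c a => //= -[x y] /eqP; rewrite eq_complex /= eqxx /= => /eqP yN.
by have -> : y = 0 by lra.
Qed.

Lemma normr_sreal (x : R) : `|sreal c x| = sreal c `|x|.
Proof. by case: c => //=; rewrite normc_def /= expr0n addr0 sqrtr_sqr. Qed.

Lemma normr_sconj (a : K) : `|sconj a| = `|a|.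
Proof. by case: c a => //= a; rewrite norm_conjC. Qed.

Lemma mul_sconj (a : K) : a * sconj a = `|a| ^+ 2.
Proof. by case: c a => //= a; [rewrite real_normK ?num_real|rewrite normCK]. Qed.

Lemma sRe_le_norm (a : K) : `|sRe a| <= sRe `|a|.
Proof.
case: c a => //= -[x y] /=; rewrite -sqrtr_sqr ler_sqrt ?lerDl ?sqr_ge0 //.
by rewrite addr_ge0 // sqr_ge0.
Qed.

End Scalars.

Section RealNorm.
Context (R : realType) (c : scalar_kind).
Local Notation K := (scalar_field R c).
Context (V : normedModType K).
Implicit Types (u v : V) (a : K).

Lemma sreal_rnorm v : sreal c (rnorm v) = `|v|.
Proof. exact: sReK. Qed.

Lemma rnorm_ge0 v : 0 <= rnorm v.
Proof. by rewrite -(ler_sreal c) sreal_rnorm rmorph0. Qed.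

Lemma rnorm0 : rnorm (0 : V) = 0.
Proof. by rewrite /rnorm normr0 raddf0. Qed.

Lemma rnorm_eq0 v : (rnorm v == 0) = (v == 0).
Proof. by rewrite -(sreal_eq0 c) sreal_rnorm normr_eq0. Qed.

Lemma rnormN v : rnorm (- v) = rnorm v.
Proof. by rewrite /rnorm normrN. Qed.

Lemma rnormB u v : rnorm (u - v) = rnorm (v - u).
Proof. by rewrite -rnormN opprB. Qed.

Lemma ler_rnormD u v : rnorm (u + v) <= rnorm u + rnorm v.
Proof. by rewrite -(ler_sreal c) raddfD /= !sreal_rnorm ler_normD. Qed.

Lemma ler_rnorm_dist u v : `|rnorm u - rnorm v| <= rnorm (u - v).
Proof.
rewrite ler_norml; have := ler_rnormD (u - v) v; have := ler_rnormD (v - u) u.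
by rewrite !subrK rnormB; lra.
Qed.

Lemma rnormZ a v : rnorm (a *: v) = rnorm (a : K^o) * rnorm v.
Proof.
apply: (@sreal_inj R c).
by rewrite rmorphM /= !sReK // normrZ.
Qed.

Lemma rnormZreal (x : R) v : rnorm (sreal c x *: v) = `|x| * rnorm v.
Proof. by rewrite rnormZ {1}/rnorm normr_sreal srealK. Qed.

Lemma ler_rnorm_sum I (r : seq I) (p : pred I) (F : I -> V) :
  rnorm (\sum_(i <- r | p i) F i) <= \sum_(i <- r | p i) rnorm (F i).
Proof.
elim/big_rec2 : _ => [|i x v _ h]; first by rewrite rnorm0.
by rewrite (le_trans (ler_rnormD _ _)) // lerD2l.
Qed.

Lemma cvg_rnormP (F : set_system nat) {FF : Filter F} (u : nat -> V) v :
  u @ F --> v <-> (fun n => rnorm (v - u n)) @ F --> (0 : R).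
Proof.
split=> [/cvgrPdist_lt h|/cvgrPdist_lt h].
  apply/cvgrPdist_lt => e e0.
  have := h (sreal c e); rewrite -(rmorph0 (@sreal R c)) ltr_sreal => /(_ e0).
  apply: filterS => n; rewrite -sreal_rnorm ltr_sreal.
  by rewrite sub0r normrN ger0_norm // rnorm_ge0.
apply/cvgrPdist_lt => e e0.
have ee : e = sreal c (sRe e) by rewrite sReK // ltW.
have e1 : 0 < sRe e by rewrite -(ltr_sreal c) -ee rmorph0.
have := h _ e1; apply: filterS => n.
rewrite sub0r normrN ger0_norm ?rnorm_ge0 //.
by rewrite -(ltr_sreal c) sreal_rnorm -ee.
Qed.

Lemma near_rnorm v (e : R) : 0 < e -> \forall u \near v, rnorm (v - u) < e.
Proof.
move=> e0; near=> u; rewrite -(ltr_sreal c) sreal_rnorm; near: u.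
have := @cvgr_dist_lt _ _ _ (nbhs v) _ id v cvg_id (sreal c e).
by apply; rewrite -(rmorph0 (@sreal R c)) ltr_sreal.
Unshelve. all: by end_near. Qed.

Lemma rnorm_continuous : continuous (@rnorm R c V).
Proof.
move=> v; apply/cvgrPdist_lt => e e0.
by apply: filterS (near_rnorm v e0) => u; exact: le_lt_trans (ler_rnorm_dist _ _).
Qed.

End RealNorm.

Lemma bounded_additive_continuous (R : realType) (c : scalar_kind)
    (V W : normedModType (scalar_field R c)) (g : V -> W) (C : R) :
  {morph g : u v / u + v} -> (forall v, rnorm (g v) <= C * rnorm v) ->
  continuous g.
Proof.
move=> gD gb v.
have g0 : g 0 = 0 by apply: (addIr (g 0)); rewrite -gD !add0r.
have gN u : g (- u) = - g u by apply: (addIr (g u)); rewrite -gD !addNr.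
apply/cvgrPdist_lt => e e0.
have ee : e = sreal c (sRe e) by rewrite sReK // ltW.
have e1 : 0 < sRe e by rewrite -(ltr_sreal c) -ee rmorph0.
have C0 : 0 < `|C| + 1 by rewrite ltr_wpDl.
have ec0 : 0 < sRe e / (`|C| + 1) by rewrite divr_gt0.
apply: filterS (near_rnorm v ec0) => u; rewrite ltr_pdivlMr // => ltv.
rewrite -gN -gD -sreal_rnorm ee ltr_sreal (le_lt_trans (gb _)) //.
rewrite (le_lt_trans _ ltv) // mulrC ler_wpM2l ?rnorm_ge0 //.
by rewrite (le_trans (ler_norm C)) // lerDl.
Qed.

(** * Strongly measurable functions *)

Section StrongMeasurability.
Context (R : realType) (c : scalar_kind) (disp : measure_display).
Local Notation K := (scalar_field R c).
Context (T : measurableType disp) (mu : {measure set T -> \bar R}).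
Hypothesis mu_complete : measure_is_complete mu.
Context (D : set T).

(** Replaces the integrals over D, a set of unknown measurability, by integrals
    over the whole space: simple functions vanish outside of D. *)
Definition zero_ext (V : nmodType) (F : T -> V) : T -> V :=
  fun t => if t \in D then F t else 0.

Lemma zero_extE (V : nmodType) (F : T -> V) t : D t -> zero_ext F t = F t.
Proof. by move=> Dt; rewrite /zero_ext mem_set. Qed.

Lemma zero_ext_out (V : nmodType) (F : T -> V) t : ~ D t -> zero_ext F t = 0.
Proof. by move=> Dt; rewrite /zero_ext memNset. Qed.

Lemma zero_ext_comp (V W : nmodType) (h : V -> W) (F : T -> V) : h 0 = 0 ->
  zero_ext (h \o F) =1 h \o zero_ext F.
Proof.
by move=> h0 t; rewrite /zero_ext /=; case: ifP => //= _; rewrite h0.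
Qed.

Lemma integral_zero_ext (g : T -> R) :
  (\int[mu]_(t in D) (g t)%:E = \int[mu]_t (zero_ext g t)%:E)%E.
Proof.
rewrite integral_mkcond; apply: eq_integral => t _.
by rewrite /zero_ext patchE; case: ifP.
Qed.

Section OneSpace.
Context (V : normedModType K).
Implicit Types (F G : T -> V) (s : mu_simple mu D V).

Lemma ms_fun_out s t : ~ D t -> ms_fun s t = 0.
Proof.
move=> nDt; rewrite /ms_fun big1 // => i _.
rewrite indicE memNset ?scale0r // => si; exact/nDt/(ms_sub si).
Qed.

(** Induction on the number of sets: the last set A, with value v, cuts the space
    into two measurable parts, where x |-> h (x + v) and h are applied to a
    simple function with fewer sets. *)
Lemma measurable_simple (h : V -> R) s :
  measurable_fun setT (fun t => h (ms_fun s t)).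
Proof.
case: s => n A v mA sA fA; rewrite /ms_fun /=.
elim: n A v mA {sA fA} h => [|n IH] A v mA h.
  by under eq_fun do rewrite big_ord0; exact: measurable_cst.
under eq_fun do rewrite big_ord_recr /= indicE.
rewrite (_ : (fun _ => _) = (fun t => if t \in A ord_max then
   h (\sum_(i < n) (\1_(A (widen_ord (leqnSn n) i)) t : K) *:
        v (widen_ord (leqnSn n) i) + v ord_max)
   else h (\sum_(i < n) (\1_(A (widen_ord (leqnSn n) i)) t : K) *:
        v (widen_ord (leqnSn n) i)))); last first.
  apply/funext => t; case: (t \in A ord_max) => /=; first by rewrite scale1r.
  by rewrite scale0r addr0.
apply: measurable_fun_ifT.
- apply: (@measurable_fun_bool _ _ setT _ true); rewrite setTI.
  rewrite (_ : _ @^-1` _ = A ord_max); first exact: mA.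
  by apply/seteqP; split=> t /=; [exact: set_mem|exact: mem_set].
- exact: (IH (fun i => A (widen_ord (leqnSn n) i))
   (fun i => v (widen_ord (leqnSn n) i)) _ (fun x => h (x + v ord_max))).
- exact: (IH (fun i => A (widen_ord (leqnSn n) i))
   (fun i => v (widen_ord (leqnSn n) i)) _ h).
Qed.

Lemma strongly_measurable_ext F : strongly_measurable mu D F ->
  exists s : nat -> mu_simple mu D V,
    {ae mu, forall t, (fun n => ms_fun (s n) t) @ \oo --> zero_ext F t}.
Proof.
move=> [s sF]; exists s; apply: filterS sF => t sF.
have [Dt|nDt] := pselect (D t); first by rewrite zero_extE //; exact: sF.
rewrite zero_ext_out //; under eq_fun do rewrite ms_fun_out //.
exact: cvg_cst.
Qed.

(** The limit function is measurable off a null set, and it can be changed on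
    this null set because the measure is complete. *)
Lemma measurable_ae_lim (g_ : nat -> T -> R) (g : T -> R) :
  (forall n, measurable_fun setT (g_ n)) ->
  {ae mu, forall t, (fun n => g_ n t) @ \oo --> g t} -> measurable_fun setT g.
Proof.
move=> mg_ [N [mN N0 gN]].
have mgN : measurable_fun setT (fun t => g t * \1_(~` N) t).
  apply: (@measurable_fun_cvg _ _ _ _ (fun n t => g_ n t * \1_(~` N) t)).
    move=> n; apply: measurable_funM => //.
    by apply: measurable_indic; exact: measurableC.
  move=> t _; rewrite indicE; have [Nt|nNt] := pselect (N t).
    rewrite memNset /=; last by apply.
    by under eq_fun do rewrite mulr0; rewrite mulr0; exact: cvg_cst.
  rewrite mem_set // mulr1; under eq_fun do rewrite mulr1.
  by have := contra_not (gN t) nNt => /contrapT.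
apply/measurable_EFinP.
apply: (ae_measurable_fun mu_complete _ ((measurable_EFinP _ _).2 mgN)).
exists N; split=> // t /= h; apply: contrapT => nNt; apply: h => _.
by rewrite indicE mem_set // mulr1.
Qed.

Lemma measurable_strong (h : V -> R) F : continuous h ->
  strongly_measurable mu D F -> measurable_fun setT (fun t => h (zero_ext F t)).
Proof.
move=> ch /strongly_measurable_ext[s sF].
apply: (@measurable_ae_lim (fun n t => h (ms_fun (s n) t))).
  by move=> n; exact: measurable_simple.
apply: filterS sF => t sF; exact: continuous_cvg (ch _) sF.
Qed.

End OneSpace.

Section SimpleConstructions.
Context (V : normedModType K).

(** The index set is an arbitrary finite type, since sums and products of simple
    functions are indexed by sums and products of index sets. *)
Definition simple_fin (I : finType) (A : I -> set T) (v : I -> V)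
    (mA : forall i, measurable (A i)) (sA : forall i, A i `<=` D)
    (fA : forall i, (mu (A i) < +oo)%E) : mu_simple mu D V :=
  @MuSimple R c disp T mu D V #|I| (A \o enum_val) (v \o enum_val)
    (fun i => mA (enum_val i)) (fun i => sA (enum_val i))
    (fun i => fA (enum_val i)).

Lemma simple_finE (I : finType) (A : I -> set T) (v : I -> V) mA sA fA t :
  ms_fun (@simple_fin I A v mA sA fA) t = \sum_(i : I) (\1_(A i) t : K) *: v i.
Proof.
rewrite /ms_fun /= [RHS](reindex_onto enum_val enum_rank) => [|i _].
  by apply: eq_bigl => i; rewrite enum_valK eqxx.
by rewrite enum_rankK.
Qed.

End SimpleConstructions.

Lemma simpleD (V : normedModType K) (s s' : mu_simple mu D V) :
  exists s2 : mu_simple mu D V, forall t, ms_fun s2 t = ms_fun s t + ms_fun s' t.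
Proof.
pose A (i : 'I_(ms_size s) + 'I_(ms_size s')) :=
  match i with inl i => ms_set i | inr i => ms_set i end.
pose v (i : 'I_(ms_size s) + 'I_(ms_size s')) :=
  match i with inl i => ms_val i | inr i => ms_val i end.
have mA i : measurable (A i) by case: i => i; exact: ms_measurable.
have sA i : A i `<=` D by case: i => i; exact: ms_sub.
have fA i : (mu (A i) < +oo)%E by case: i => i; exact: ms_finite.
by exists (simple_fin v mA sA fA) => t; rewrite simple_finE big_sumType.
Qed.

Lemma simple_map (V W : normedModType K) (g : V -> W) (s : mu_simple mu D V) :
  {morph g : x y / x + y} ->
  exists s2 : mu_simple mu D W, forall t, ms_fun s2 t = g (ms_fun s t).
Proof.
move=> gD; have g0 : g 0 = 0 by apply: (addIr (g 0)); rewrite -gD !add0r.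
exists (@MuSimple R c disp T mu D W (ms_size s) _ (g \o @ms_val _ _ _ _ _ _ _ s)
  (@ms_measurable _ _ _ _ _ _ _ s) (@ms_sub _ _ _ _ _ _ _ s)
  (@ms_finite _ _ _ _ _ _ _ s)) => t.
rewrite /ms_fun /= (big_morph g gD g0); apply: eq_bigr => i _.
by rewrite indicE; case: (_ \in _); rewrite ?scale1r // !scale0r.
Qed.

Lemma simple_scale (V : normedModType K) (a : mu_simple mu D K^o)
    (s : mu_simple mu D V) :
  exists s2 : mu_simple mu D V, forall t, ms_fun s2 t = ms_fun a t *: ms_fun s t.
Proof.
pose A (i : 'I_(ms_size a) * 'I_(ms_size s)) := ms_set i.1 `&` ms_set i.2.
pose v (i : 'I_(ms_size a) * 'I_(ms_size s)) := (ms_val i.1 : K) *: ms_val i.2.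
have mA i : measurable (A i) by apply: measurableI; exact: ms_measurable.
have sA i : A i `<=` D by move=> t [] /ms_sub.
have fA i : (mu (A i) < +oo)%E.
  apply: le_lt_trans (ms_finite i.1); apply: le_measure; rewrite ?inE //.
    exact: ms_measurable.
  exact: subIsetl.
exists (simple_fin v mA sA fA) => t; rewrite simple_finE /ms_fun.
rewrite scaler_suml; under [RHS]eq_bigr => i _ do rewrite scaler_sumr.
rewrite pair_big /=; apply: eq_bigr => -[i j] _ /=.
rewrite /v /A /= !indicE in_setI.
by case: (t \in ms_set i); case: (t \in ms_set j);
  rewrite /= ?scale1r ?scale0r ?scaler0.
Qed.

Lemma strongly_measurableD (V : normedModType K) (F G : T -> V) :
  strongly_measurable mu D F -> strongly_measurable mu D G ->
  strongly_measurable mu D (fun t => F t + G t).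
Proof.
move=> [s sF] [s' sG].
have [s2 s2E] := choice (fun n => simpleD (s n) (s' n)).
exists s2; apply: filterS2 sF sG => t sF sG Dt.
by under eq_fun do rewrite s2E; exact: cvgD (sF Dt) (sG Dt).
Qed.

Lemma strongly_measurable_map (V W : normedModType K) (g : V -> W) (F : T -> V) :
  {morph g : x y / x + y} -> continuous g ->
  strongly_measurable mu D F -> strongly_measurable mu D (g \o F).
Proof.
move=> gD cg [s sF].
have [s2 s2E] := choice (fun n => simple_map (s n) gD).
exists s2; apply: filterS sF => t sF Dt.
by under eq_fun do rewrite s2E; exact: continuous_cvg (cg _) (sF Dt).
Qed.

Lemma strongly_measurable_scale (V : normedModType K) (a : T -> K^o) (F : T -> V) :
  strongly_measurable mu D a -> strongly_measurable mu D F ->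
  strongly_measurable mu D (fun t => (a t : K) *: F t).
Proof.
move=> [s sF] [s' sG].
have [s2 s2E] := choice (fun n => simple_scale (s n) (s' n)).
exists s2; apply: filterS2 sF sG => t sF sG Dt.
by under eq_fun do rewrite s2E; exact: cvgZ (sF Dt) (sG Dt).
Qed.

Lemma strongly_measurable_simple (V : normedModType K) (s : mu_simple mu D V) :
  strongly_measurable mu D (ms_fun s).
Proof. by exists (fun=> s); apply: aeW => t _; exact: cvg_cst. Qed.

Lemma strongly_measurable0 (V : normedModType K) :
  strongly_measurable mu D (fun=> 0 : V).
Proof.
pose s := simple_fin (V := V) (I := 'I_0) (A := fun=> set0) (fun=> 0)
  (fun=> measurable0) (fun=> @sub0set _ _) (fun i => match i with Ordinal _ h =>
     False_rect _ (notF h) end).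
exists (fun=> s); apply: aeW => t _.
by rewrite simple_finE big_ord0; exact: cvg_cst.
Qed.

End StrongMeasurability.

(** * Bochner integral *)

Lemma cvg0_dominated (R : realType) (C : R) (u : nat -> R) (e : nat -> \bar R) :
  (forall n, (`|u n|%:E <= C%:E * e n)%E) -> e @ \oo --> 0%E -> u @ \oo --> 0.
Proof.
move=> ue e0; apply: norm_cvg0.
have Ce0 : (fun n => C%:E * e n)%E @ \oo --> 0%E.
  by rewrite -[X in _ --> X](mule0 C%:E); apply: cvgeZl.
have : (fun n => `|u n|%:E) @ \oo --> 0%E.
  apply: (squeeze_cvge _ (cvg_cst 0%E) Ce0).
  by apply: nearW => n; rewrite lee_fin normr_ge0 ue.
by move/fine_cvgP => [].
Qed.

Section RealFunctionals.
Context (R : realType) (c : scalar_kind).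
Local Notation K := (scalar_field R c).

Definition seq_complete (V : normedModType K) := forall u : nat -> V,
  (forall e : R, 0 < e ->
     exists N, forall m n, (N <= m)%N -> (N <= n)%N -> rnorm (u m - u n) < e) ->
  exists v : V, u @ \oo --> v.

Lemma complete_seq_complete (V : completeNormedModType K) : seq_complete V.
Proof.
move=> u h; suff : cvg (u @ \oo) by move=> ?; exists (lim (u @ \oo)).
apply/cauchy_cvgP/cauchy_exP => e e0.
have ee : e = sreal c (sRe e) by rewrite sReK // ltW.
have e1 : 0 < sRe e by rewrite -(ltr_sreal c) -ee rmorph0.
have [N hN] := h _ e1; exists (u N).
exists N => // n Nn /=; rewrite -ball_normE /= ee -sreal_rnorm ltr_sreal.
by apply: hN => //=.
Qed.

Record real_functional (V : normedModType K) (l : V -> R) : Prop := RealFunctional {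
  rf_add : {morph l : u v / u + v} ;
  rf_scale : forall x v, l (sreal c x *: v) = x * l v ;
  rf_bound : exists C, forall v, `|l v| <= C * rnorm v }.

(** This consequence of the Hahn-Banach theorem is immediate for inner product
    spaces and for the scalars; it reduces the Bochner integral to the integrals
    of real functions. *)
Definition norming (V : normedModType K) :=
  forall u : V, exists l : V -> R,
    [/\ real_functional l, l u = rnorm u & forall v, `|l v| <= rnorm v].

Definition integration_space (V : normedModType K) := seq_complete V /\ norming V.

Context (V : normedModType K) (l : V -> R).
Hypothesis rl : real_functional l.

Lemma rf0 : l 0 = 0.
Proof. by apply: (addIr (l 0)); rewrite -(rf_add rl) !add0r. Qed.

Lemma rfN v : l (- v) = - l v.
Proof. by apply: (addIr (l v)); rewrite -(rf_add rl) !addNr rf0. Qed.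

Lemma rfB u v : l (u - v) = l u - l v.
Proof. by rewrite (rf_add rl) rfN. Qed.

Lemma rf_sum I (r : seq I) (p : pred I) (F : I -> V) :
  l (\sum_(i <- r | p i) F i) = \sum_(i <- r | p i) l (F i).
Proof. exact: (big_morph l (rf_add rl) rf0). Qed.

Lemma rf_continuous : continuous l.
Proof.
move=> v; have [C lC] := rf_bound rl.
apply/cvgrPdist_lt => e e0.
have C0 : 0 < `|C| + 1 by rewrite ltr_wpDl.
have ec0 : 0 < e / (`|C| + 1) by rewrite divr_gt0.
apply: filterS (near_rnorm v ec0) => u; rewrite ltr_pdivlMr // => ltv.
rewrite -rfB (le_lt_trans (lC _)) // (le_lt_trans _ ltv) // mulrC.
by rewrite ler_wpM2l ?rnorm_ge0 // (le_trans (ler_norm C)) // lerDl.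
Qed.

End RealFunctionals.

Section Bochner.
Context (R : realType) (c : scalar_kind) (disp : measure_display).
Local Notation K := (scalar_field R c).
Context (T : measurableType disp) (mu : {measure set T -> \bar R}).
Hypothesis mu_complete : measure_is_complete mu.
Context (D : set T).

Definition bochner_integrable (V : normedModType K) (F : T -> V) :=
  strongly_measurable mu D F /\ (\int[mu]_(t in D) (rnorm (F t))%:E < +oo)%E.

Section Functionals.
Context (V : normedModType K).
Implicit Types (F G : T -> V) (s : mu_simple mu D V) (l : V -> R).

Local Notation ext F := (zero_ext D F).

Lemma integral_rnorm_ext F :
  (\int[mu]_(t in D) (rnorm (F t))%:E = \int[mu]_t (rnorm (ext F t))%:E)%E.
Proof.
rewrite integral_zero_ext; apply: eq_integral => t _.
by rewrite (zero_ext_comp D F (rnorm0 V)).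
Qed.

Lemma measurable_ext_sub (h : V -> R) F s : continuous h ->
  strongly_measurable mu D F ->
  measurable_fun setT (fun t => h (ext F t - ms_fun s t)).
Proof.
move=> ch mF; have : strongly_measurable mu D (fun t => F t + - ms_fun s t).
  apply: strongly_measurableD => //.
  have := @strongly_measurable_map _ _ _ _ mu D V V -%R (ms_fun s).
  apply; [exact: opprD|exact: opp_continuous|exact: strongly_measurable_simple].
move=> /(measurable_strong mu_complete ch); apply: eq_measurable_fun => t _.
congr h; have [Dt|nDt] := pselect (D t); first by rewrite !zero_extE.
by rewrite !zero_ext_out // ms_fun_out // subr0.
Qed.

Lemma integral_dist_ext F s :
  (\int[mu]_(t in D) (rnorm (F t - ms_fun s t))%:E =
   \int[mu]_t (rnorm (ext F t - ms_fun s t))%:E)%E.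
Proof.
rewrite integral_rnorm_ext; apply: eq_integral => t _; congr (rnorm _)%:E.
have [Dt|nDt] := pselect (D t); first by rewrite !zero_extE.
by rewrite !zero_ext_out // ms_fun_out // subr0.
Qed.

(** The sets of a simple function may overlap, but l applied to it is a linear
    combination of their indicators, whatever their position. *)
Lemma integral_functional_simple l s : real_functional l ->
  mu.-integrable setT (fun t => (l (ms_fun s t))%:E) /\
  (\int[mu]_t (l (ms_fun s t))%:E)%E = (l (ms_integral s))%:E.
Proof.
move=> rl.
have lE : (fun t => (l (ms_fun s t))%:E) = (fun t => \sum_(i < ms_size s)
    ((l (ms_val i))%:E * (\1_(ms_set i) t : R)%:E))%E.
  apply/funext => t; rewrite (rf_sum rl) sumEFin; congr EFin.
  apply: eq_bigr => i _; rewrite !indicE.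
  by case: (_ \in _); rewrite ?scale1r ?scale0r ?(rf0 rl) ?mulr1 ?mulr0.
have int1 (i : 'I_(ms_size s)) : mu.-integrable setT
    (fun t => (\1_(ms_set i) t : R)%:E).
  apply/integrableP; split.
    by apply/measurable_EFinP/measurable_indic; exact: ms_measurable.
  under eq_integral do rewrite gee0_abs ?lee_fin //.
  by rewrite integral_indic ?setIT //; [exact: ms_finite|exact: ms_measurable].
have int2 (i : 'I_(ms_size s)) : mu.-integrable setT
    (fun t => ((l (ms_val i))%:E * (\1_(ms_set i) t : R)%:E)%E).
  exact: integrableZl.
rewrite lE; split; first exact: integrable_sum.
rewrite integral_sum // (rf_sum rl) -sumEFin; apply: eq_bigr => i _.
rewrite integralZl // integral_indic //; last exact: ms_measurable.
rewrite setIT (rf_scale rl) mulrC EFinM fineK // ge0_fin_numE //.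
exact: ms_finite.
Qed.

Lemma bochner_integrable_rnorm F : bochner_integrable F ->
  mu.-integrable setT (fun t => (rnorm (ext F t))%:E).
Proof.
move=> [mF intF]; apply/integrableP; split.
  apply/measurable_EFinP.
  exact: (measurable_strong mu_complete (@rnorm_continuous _ _ V) mF).
under eq_integral do rewrite gee0_abs ?lee_fin ?rnorm_ge0 //.
by rewrite -integral_rnorm_ext.
Qed.

Lemma bochner_integrable_functional l F : real_functional l ->
  bochner_integrable F -> mu.-integrable setT (fun t => (l (ext F t))%:E).
Proof.
move=> rl intF; have [C lC] := rf_bound rl.
apply: (le_integrable _ _ _ (integrableZl _ C (bochner_integrable_rnorm intF))).
- by [].
- by apply/measurable_EFinP/measurable_strong; [|exact: rf_continuous|exact: intF.1].
- by move=> t _; rewrite lee_fin (le_trans (lC _)) // ler_norm.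
- by [].
Qed.

(** If the simple functions s n approximate F in mean, the integrals of l (s n)
    are l applied to the integrals of s n, and they tend to l v as well as to
    the integral of l F. *)
Lemma is_bochner_functional l F v : real_functional l ->
  bochner_integrable F -> is_bochner mu D F v ->
  (\int[mu]_t (l (ext F t))%:E)%E = (l v)%:E.
Proof.
move=> rl intF [mF [s [es sv]]]; have [C lC] := rf_bound rl.
have il := bochner_integrable_functional rl intF.
have ifin := integrable_fin_num measurableT il.
set I := (X in X = _); rewrite -(fineK ifin : _ = I); congr EFin.
have C0 : 0 <= `|C| by [].
have lsv : (fun n => l (ms_integral (s n))) @ \oo --> l v.
  exact: continuous_cvg (rf_continuous rl (x := v)) sv.
suff lsI : (fun n => l (ms_integral (s n))) @ \oo --> fine I.
  by apply: cvg_unique lsI lsv.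
rewrite -[X in _ --> X]subr0.
rewrite (_ : (fun n => _) = (fun n => fine I - (fine I - l (ms_integral (s n))))).
  apply: cvgB; first exact: cvg_cst.
  apply: (@cvg0_dominated _ `|C| _ _ _ es) => n.
  have [is_ isE] := integral_functional_simple (s n) rl.
  rewrite -abse_EFin EFinB fineK // -isE -integralB // integral_dist_ext.
  have md : measurable_fun setT (fun t => (rnorm (ext F t - ms_fun (s n) t))).
    exact: measurable_ext_sub (@rnorm_continuous _ _ V) mF.
  apply: le_trans (le_abse_integral _ _ _) _ => //.
    exact: measurable_int (integrableB _ il is_).
  rewrite -ge0_integralZl //; last 2 first.
  - exact/measurable_EFinP.
  - by move=> t _; rewrite lee_fin rnorm_ge0.
  apply: ge0_le_integral => //.
  - by apply: measurableT_comp => //; exact: measurable_int (integrableB _ il is_).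
  - by apply: measurable_funeM; exact/measurable_EFinP.
  - move=> t _; rewrite -EFinB -rfB // lee_fin (le_trans (lC _)) //.
    by rewrite ler_wpM2r ?rnorm_ge0 // ler_norm.
by apply/funext => n; rewrite opprB addrC subrK.
Qed.

End Functionals.

Section Existence.
Context (V : normedModType K).
Hypotheses (complete_V : seq_complete V) (norming_V : norming V).
Implicit Types (F G : T -> V) (s : mu_simple mu D V).

Local Notation ext F := (zero_ext D F).

Lemma simple_restrict (B : set T) s : measurable B ->
  exists s2 : mu_simple mu D V,
    forall t, ms_fun s2 t = if t \in B then ms_fun s t else 0.
Proof.
move=> mB; pose A i := ms_set (m := s) i `&` B.
have mA i : measurable (A i) by apply: measurableI => //; exact: ms_measurable.
have sA i : A i `<=` D by move=> t [] /ms_sub.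
have fA i : (mu (A i) < +oo)%E.
  apply: le_lt_trans (ms_finite (m := s) i); apply: le_measure; rewrite ?inE //.
    exact: ms_measurable.
  exact: subIsetl.
exists (simple_fin (@ms_val _ _ _ _ _ _ _ s) mA sA fA) => t; rewrite simple_finE.
case: ifPn => tB; [|rewrite big1 //] => [|i _].
  by apply: eq_bigr => i _; rewrite !indicE in_setI tB andbT.
by rewrite indicE in_setI (negPf tB) andbF scale0r.
Qed.

(** The pointwise approximations s n are truncated to the sets where
    |s n| <= 2 |F|. There 3 |F| dominates the error, and almost every point at
    which F is not zero belongs to all but finitely many of these sets. *)
Lemma simple_approximation F : bochner_integrable F ->
  exists s : nat -> mu_simple mu D V,
    (fun n => \int[mu]_(t in D) (rnorm (F t - ms_fun (s n) t))%:E)%E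
      @ \oo --> 0%E.
Proof.
move=> intF; have [mF _] := intF.
have [s sF] := strongly_measurable_ext mF.
pose B n := [set t | rnorm (ms_fun (s n) t) <= 2 * rnorm (ext F t)].
have mrF : measurable_fun setT (fun t => rnorm (ext F t)).
  exact: (measurable_strong mu_complete (@rnorm_continuous _ _ V) mF).
have mB n : measurable (B n).
  have := measurable_fun_ler (measurable_simple (@rnorm _ _ V) (s n))
    (measurable_funM (measurable_cst (2 : R)) mrF).
  move=> /(_ measurableT [set true] I); rewrite setTI => mB.
  exact: mB.
have [s' s'E] := choice (fun n => simple_restrict (s n) (mB n)).
exists s'; under eq_fun do rewrite integral_dist_ext.
have [] := @dominated_convergence _ _ _ mu setT measurableT
  (fun n t => (rnorm (ext F t - ms_fun (s' n) t))%:E) (cst 0%E)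
  (fun t => (3%:E * (rnorm (ext F t))%:E)%E).
- move=> n; apply/measurable_EFinP.
  exact: measurable_ext_sub (@rnorm_continuous _ _ V) mF.
- exact: measurable_cst.
- apply: filterS sF => t sFt _; apply: cvg_EFin; first exact: nearW.
  apply/cvg_rnormP.
  have [F0|F0] := eqVneq (ext F t) 0.
    rewrite F0 (_ : (fun _ => _) = cst 0); first exact: cvg_cst.
    apply/funext => n; rewrite s'E; case: ifPn => // /set_mem; rewrite /B /= F0.
    by rewrite rnorm0 mulr0 => h; apply/eqP; rewrite -rnorm_eq0 eq_le h rnorm_ge0.
  have F1 : 0 < rnorm (ext F t) by rewrite lt_neqAle eq_sym rnorm_eq0 F0 rnorm_ge0.
  have sFn : \forall n \near \oo,
      rnorm (ext F t - ms_fun (s n) t) < rnorm (ext F t).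
    exact: sFt _ (near_rnorm (ext F t) F1).
  apply: cvg_trans sFt; apply: near_eq_cvg; apply: filterS sFn => n /= h.
  rewrite s'E mem_set //; rewrite /B /=.
  have := ler_rnorm_dist (ms_fun (s n) t) (ext F t).
  by rewrite rnormB ler_norml => /andP[_]; lra.
- exact: integrableZl (bochner_integrable_rnorm intF).
- apply: aeW => t n _; rewrite -EFinM lee_fin ger0_norm ?rnorm_ge0 // s'E.
  case: ifPn => [/set_mem|_].
    rewrite /B /= => h; have := ler_rnormD (ext F t) (- ms_fun (s n) t).
    by rewrite rnormN; lra.
  by rewrite subr0; have := rnorm_ge0 (ext F t); lra.
move=> _ _; rewrite integral0 => h; apply: cvg_trans h.
by apply: near_eq_cvg; exact: nearW.
Qed.

(** For a functional l that norms the difference, the left-hand side is the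
    integral of l (s - s'), and s - s' = (F - s') - (F - s). *)
Lemma ms_integral_dist F s s' : bochner_integrable F ->
  ((rnorm (ms_integral s - ms_integral s'))%:E <=
   \int[mu]_(t in D) (rnorm (F t - ms_fun s t))%:E +
   \int[mu]_(t in D) (rnorm (F t - ms_fun s' t))%:E)%E.
Proof.
move=> intF; have [mF _] := intF.
have [l [rl lE lb]] := norming_V (ms_integral s - ms_integral s').
have [i1 e1] := integral_functional_simple s rl.
have [i2 e2] := integral_functional_simple s' rl.
have md s1 : measurable_fun setT (fun t => (rnorm (ext F t - ms_fun s1 t))%:E).
  apply/measurable_EFinP.
  exact: measurable_ext_sub (@rnorm_continuous _ _ V) mF.
rewrite -lE rfB // EFinB -e1 -e2 -integralB // !integral_dist_ext.
rewrite -ge0_integralD //; last 2 first.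
- by move=> t _; rewrite lee_fin rnorm_ge0.
- by move=> t _; rewrite lee_fin rnorm_ge0.
apply: le_trans (lee_abs _) _.
have mI := measurable_int _ (integrableB measurableT i1 i2).
apply: le_trans (le_abse_integral _ _ mI) _ => //.
apply: ge0_le_integral => //.
- exact: measurableT_comp.
- exact: emeasurable_funD.
- move=> t _; rewrite -EFinB -EFinD -rfB // lee_fin (le_trans (lb _)) //.
  rewrite [leRHS]addrC -(rnormN (ext F t - ms_fun s t)).
  apply: le_trans (ler_rnormD _ _); rewrite opprB.
  by rewrite [X in _ <= rnorm X]addrC addrA subrK.
Qed.

Lemma bochner_exists F : bochner_integrable F -> exists v, is_bochner mu D F v.
Proof.
move=> intF; have [s es] := simple_approximation intF.
have [v sv] : exists v : V, (fun n => ms_integral (s n)) @ \oo --> v.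
  apply: complete_V => e e0.
  have /fine_cvgP[[N1 _ fin1]] := es.
  move=> /cvgrPdist_lt/(_ (e / 2)); rewrite divr_gt0 // => /(_ isT)[N2 _ lt2].
  exists (maxn N1 N2) => m n; rewrite !geq_max => /andP[m1 m2] /andP[n1 n2].
  rewrite -lte_fin; apply: le_lt_trans (ms_integral_dist _ _ intF) _.
  have := lt2 _ m2; have := lt2 _ n2; rewrite /= !sub0r !normrN.
  have := fin1 _ m1; have := fin1 _ n1 => /= /fineK <- /fineK <-.
  by rewrite -EFinD lte_fin => /ltr_normlW ? /ltr_normlW ?; lra.
by exists v; split; [case: intF|exists s].
Qed.

Lemma bochnerP F : bochner_integrable F -> is_bochner mu D F (bochner mu D F).
Proof.
move=> /bochner_exists[v vF].
by apply: (@xgetPex _ 0 [set v | is_bochner mu D F v]); exists v.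
Qed.

Lemma bochner_functional (l : V -> R) F : real_functional l ->
  bochner_integrable F ->
  (l (bochner mu D F))%:E = (\int[mu]_t (l (ext F t))%:E)%E.
Proof.
by move=> rl iF; rewrite (is_bochner_functional rl iF (bochnerP iF)).
Qed.

Lemma norming_eq (u v : V) :
  (forall l : V -> R, real_functional l -> l u = l v) -> u = v.
Proof.
move=> h; have [l [rl lE _]] := norming_V (u - v).
by apply/eqP; rewrite -subr_eq0 -rnorm_eq0 -lE rfB // h // subrr.
Qed.

Lemma rnorm_bochner F : bochner_integrable F ->
  ((rnorm (bochner mu D F))%:E <= \int[mu]_(t in D) (rnorm (F t))%:E)%E.
Proof.
move=> iF; have [l [rl lE lb]] := norming_V (bochner mu D F).
rewrite -lE bochner_functional // integral_rnorm_ext.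
have il := bochner_integrable_functional rl iF.
have ir := bochner_integrable_rnorm iF.
apply: le_integral => // t _.
by rewrite lee_fin (le_trans (ler_norm _)).
Qed.

End Existence.

Lemma bochner_integrableD (V : normedModType K) (F G : T -> V) :
  bochner_integrable F -> bochner_integrable G ->
  bochner_integrable (fun t => F t + G t).
Proof.
move=> iF iG; have [mF _] := iF; have [mG _] := iG.
split; first exact: strongly_measurableD.
have mFG := strongly_measurableD mF mG.
rewrite integral_rnorm_ext.
have iD := integrableD measurableT (bochner_integrable_rnorm iF)
  (bochner_integrable_rnorm iG).
have /integrableP[_] := iD; apply: le_lt_trans; apply: ge0_le_integral => //.
- by move=> t _; rewrite lee_fin rnorm_ge0.
- apply/measurable_EFinP.
  exact: (measurable_strong mu_complete (@rnorm_continuous _ _ V) mFG).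
- by apply: measurableT_comp => //; exact: measurable_int iD.
- move=> t _; rewrite -EFinD lee_fin ger0_norm ?addr_ge0 ?rnorm_ge0 //.
  apply: le_trans _ (ler_rnormD _ _).
  by rewrite /zero_ext; case: ifP; rewrite ?addr0.
Qed.

(** The bounded real-linear maps commute with the Bochner integral, since
    composition with them preserves the real functionals. *)
Lemma bochner_map (V W : normedModType K) (g : V -> W) (F : T -> V) (C : R) :
  integration_space V -> integration_space W -> {morph g : u v / u + v} ->
  (forall x v, g (sreal c x *: v) = sreal c x *: g v) ->
  (forall v, rnorm (g v) <= C * rnorm v) ->
  bochner_integrable F ->
  bochner_integrable (g \o F) /\ bochner mu D (g \o F) = g (bochner mu D F).
Proof.
move=> [cV nV] [cW nW] gD gZ gb iF.
have g0 : g 0 = 0 by apply: (addIr (g 0)); rewrite -gD !add0r.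
have cg := bounded_additive_continuous gD gb.
have [mF intF] := iF.
have ig : bochner_integrable (g \o F).
  split; first exact: strongly_measurable_map.
  rewrite integral_rnorm_ext.
  have := integrableZl measurableT C (bochner_integrable_rnorm iF).
  move=> h; have /integrableP[_] := h; apply: le_lt_trans.
  apply: ge0_le_integral => //.
  - by move=> t _; rewrite lee_fin rnorm_ge0.
  - apply/measurable_EFinP/(measurable_strong mu_complete (@rnorm_continuous _ _ W)).
    exact: strongly_measurable_map.
  - by apply: measurableT_comp => //; exact: measurable_int h.
  - move=> t _; rewrite zero_ext_comp // lee_fin (le_trans (gb _)) //.
    exact: ler_norm.
split=> //; apply: (norming_eq nW) => l rl.
have rlg : real_functional (l \o g).
  split=> [u v|x v|] /=; first by rewrite gD (rf_add rl).
    by rewrite gZ (rf_scale rl).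
  have [B lB] := rf_bound rl; exists (`|B| * C) => v.
  rewrite (le_trans (lB _)) // -mulrA.
  rewrite (le_trans (ler_wpM2r (rnorm_ge0 _) (ler_norm B))) //.
  by rewrite ler_wpM2l.
apply: EFin_inj; rewrite (bochner_functional cW nW rl ig).
rewrite -[l (g _)]/((l \o g) _) (bochner_functional cV nV rlg iF).
by apply: eq_integral => t _; rewrite zero_ext_comp.
Qed.

Lemma bochnerD (V : normedModType K) (F G : T -> V) : integration_space V ->
  bochner_integrable F -> bochner_integrable G ->
  bochner mu D (fun t => F t + G t) = bochner mu D F + bochner mu D G.
Proof.
move=> [cV nV] iF iG; apply: (norming_eq nV) => l rl; apply: EFin_inj.
have iFG := bochner_integrableD iF iG.
have := bochner_functional cV nV rl iFG.
have := bochner_functional cV nV rl iF; have := bochner_functional cV nV rl iG.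
move: (bochner mu D F) (bochner mu D G) (bochner mu D (fun t => F t + G t)).
move=> a b d eb ea ed.
rewrite ed (rf_add rl) EFinD ea eb.
have il1 := bochner_integrable_functional rl iF.
have il2 := bochner_integrable_functional rl iG.
rewrite -integralD //; apply: eq_integral => t _.
by rewrite -EFinD -(rf_add rl) /zero_ext; case: ifP; rewrite ?addr0.
Qed.

Lemma bochner_integrable_sum (V : normedModType K) n (F : 'I_n -> T -> V) :
  (forall i, bochner_integrable (F i)) ->
  bochner_integrable (fun t => \sum_(i < n) F i t).
Proof.
elim: n F => [|n IH] F iF.
  split; first by under eq_fun do rewrite big_ord0; exact: strongly_measurable0.
  rewrite integral_rnorm_ext (eq_integral (cst 0%E)) ?integral0 // => t _.
  by rewrite /zero_ext big_ord0 if_same rnorm0.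
under eq_fun do rewrite big_ord_recr /=.
by apply: bochner_integrableD => //; apply: IH.
Qed.

Lemma bochnerZ (V : normedModType K) (a : K) (F : T -> V) :
  integration_space V -> bochner_integrable F ->
  bochner_integrable (fun t => a *: F t) /\
  bochner mu D (fun t => a *: F t) = a *: bochner mu D F.
Proof.
move=> iV iF.
apply: (bochner_map (g := fun v : V => a *: v) (C := rnorm (a : K^o)) iV iV _ _ _ iF).
- by move=> u v; rewrite scalerDr.
- by move=> x v; rewrite !scalerA mulrC.
- by move=> v; rewrite rnormZ.
Qed.

End Bochner.

(** * Inner products *)

Section InnerProduct.
Context (R : realType) (c : scalar_kind) (H : hilbertSpace R c).
Local Notation K := (scalar_field R c).
Implicit Types (x y z : H) (a : K).

Lemma hdotC x y : hdot H y x = sconj (hdot H x y).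
Proof. by rewrite hermC expr0 mul1r. Qed.

Lemma hdotDl x y z : hdot H (x + y) z = hdot H x z + hdot H y z.
Proof. exact: linearDl. Qed.

Lemma hdotZl a x y : hdot H (a *: x) y = a * hdot H x y.
Proof. exact: linearZl_LR. Qed.

Lemma hdot0l y : hdot H 0 y = 0.
Proof. exact: linear0l. Qed.

Lemma hdotBl x y z : hdot H (x - y) z = hdot H x z - hdot H y z.
Proof. exact: linearBl. Qed.

Lemma hdot_suml I (r : seq I) (p : pred I) (F : I -> H) y :
  hdot H (\sum_(i <- r | p i) F i) y = \sum_(i <- r | p i) hdot H (F i) y.
Proof. exact: (big_morph (fun x => hdot H x y) (fun u v => hdotDl u v y) (hdot0l y)). Qed.

Lemma hdot0r x : hdot H x 0 = 0.
Proof. by rewrite hdotC hdot0l rmorph0. Qed.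

Lemma hdotBr x y z : hdot H x (y - z) = hdot H x y - hdot H x z.
Proof. by rewrite hdotC hdotBl rmorphB /= -!hdotC. Qed.

Lemma hdotZr a x y : hdot H x (a *: y) = sconj a * hdot H x y.
Proof. by rewrite hdotC hdotZl rmorphM /= -hdotC. Qed.

Lemma hdotxx x : hdot H x x = sreal c (rnorm x ^+ 2).
Proof. by rewrite -hdot_norm rmorphXn /= sreal_rnorm. Qed.

Lemma hdot_eq0 x : hdot H x x = 0 -> x = 0.
Proof.
rewrite hdotxx => /eqP; rewrite sreal_eq0 sqrf_eq0 rnorm_eq0; exact: eqP.
Qed.

Lemma rnormD_orthogonal x y : hdot H x y = 0 ->
  rnorm (x + y) ^+ 2 = rnorm x ^+ 2 + rnorm y ^+ 2.
Proof.
move=> xy0; have yx0 : hdot H y x = 0 by rewrite hdotC xy0 rmorph0.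
apply: (@sreal_inj R c); rewrite rmorphD /= -!hdotxx hdotDl.
rewrite (hdotC (x + y) x) (hdotC (x + y) y) !hdotDl xy0 yx0 addr0 add0r.
by rewrite -!hdotC.
Qed.

(** The projection p of x onto the line of y is not longer than x, by
    Pythagoras. *)
Lemma cauchy_schwarz x y : rnorm (hdot H x y : K^o) <= rnorm x * rnorm y.
Proof.
have [->|y0] := eqVneq y 0; first by rewrite hdot0r !rnorm0 mulr0.
have ny : 0 < rnorm y by rewrite lt_neqAle eq_sym rnorm_eq0 y0 rnorm_ge0.
have yy0 : hdot H y y != 0 by apply: contra_neq y0; exact: hdot_eq0.
pose p := (hdot H x y / hdot H y y) *: y.
have pxy : hdot H (x - p) p = 0.
  by rewrite hdotZr hdotBl hdotZl divfK // subrr mulr0.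
have := rnormD_orthogonal pxy; rewrite subrK => e.
have : rnorm p ^+ 2 <= rnorm x ^+ 2 by rewrite e lerDr sqr_ge0.
rewrite ler_pXn2r ?nnegrE ?rnorm_ge0 // => hp.
rewrite -ler_pdivrMr //; apply: le_trans hp; rewrite rnormZ.
suff -> : rnorm (hdot H x y / hdot H y y : K^o) =
    rnorm (hdot H x y : K^o) / rnorm y ^+ 2.
  by rewrite expr2 invfM mulrA divfK // gt_eqF.
apply: (@sreal_inj R c); rewrite rmorphM fmorphV rmorphXn /= !sreal_rnorm.
by rewrite normrM normfV hdotxx normr_sreal (ger0_norm (sqr_ge0 _)) rmorphXn /= sreal_rnorm.
Qed.

Lemma hdot_cvg (u : nat -> H) x y : u @ \oo --> x ->
  (fun n => hdot H (u n) y : K^o) @ \oo --> (hdot H x y : K^o).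
Proof.
move=> /cvg_rnormP ux; apply/cvg_rnormP.
have h : (fun n => rnorm (x - u n) * rnorm y) @ \oo --> (0 : R).
  by rewrite -(mul0r (rnorm y)); apply: cvgM => //; exact: cvg_cst.
apply: (squeeze_cvgr _ (cvg_cst 0) h).
apply: nearW => n; rewrite rnorm_ge0 /=.
by rewrite -hdotBl; exact: cauchy_schwarz.
Qed.

End InnerProduct.

Section IntegrationSpaces.
Context (R : realType) (c : scalar_kind).
Local Notation K := (scalar_field R c).

Lemma real_functional_sRe : @real_functional R c K^o (@sRe R c).
Proof.
split=> [u v|x v|]; [exact: raddfD|exact: sReM|].
by exists 1 => v; rewrite mul1r; exact: sRe_le_norm.
Qed.

(** The functional is v |-> Re <v, u> / |u|, where g stands for <_, u>. *)
Lemma norming_of_bound (V : normedModType K) (u : V) (g : V -> K) :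
  {morph g : x y / x + y} -> (forall a v, g (a *: v) = a * g v) ->
  (forall v, rnorm (g v : K^o) <= rnorm v * rnorm u) ->
  g u = sreal c (rnorm u ^+ 2) ->
  exists l : V -> R,
    [/\ real_functional l, l u = rnorm u & forall v, `|l v| <= rnorm v].
Proof.
move=> gD gZ gb gu; have [u0|u0] := eqVneq u 0.
  exists (fun=> 0); split; last by move=> v; rewrite normr0 rnorm_ge0.
    by split=> [?|?|]; rewrite ?addr0 ?mulr0 //;
       exists 0 => v; rewrite normr0 mul0r.
  by rewrite u0 rnorm0.
have nu : 0 < rnorm u by rewrite lt_neqAle eq_sym rnorm_eq0 u0 rnorm_ge0.
have lb v : `|sRe (g v) / rnorm u| <= rnorm v.
  rewrite normrM normfV (gtr0_norm nu) ler_pdivrMr //.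
  exact: le_trans (sRe_le_norm _) (gb v).
exists (fun v => sRe (g v) / rnorm u); split=> //.
  split=> [x y|x v|]; first by rewrite gD raddfD mulrDl.
    by rewrite gZ sReM mulrA.
  by exists 1 => v; rewrite mul1r.
by rewrite gu srealK expr2 mulfK // gt_eqF.
Qed.

Lemma norming_hilbert (H : hilbertSpace R c) : norming H.
Proof.
move=> u; apply: (norming_of_bound (g := fun v => hdot H v u)).
- by move=> x y; exact: hdotDl.
- by move=> a v; exact: hdotZl.
- by move=> v; exact: cauchy_schwarz.
- exact: hdotxx.
Qed.

Lemma norming_scalar : norming (K^o).
Proof.
move=> u; apply: (norming_of_bound (g := fun v : K^o => v * sconj u)).
- by move=> x y; rewrite mulrDl.
- by move=> a v; rewrite [a *: v]/(a * v) mulrA.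
- move=> v; rewrite -(ler_sreal c) rmorphM /= !sreal_rnorm normrM normr_sconj.
  exact: lexx.
- by rewrite mul_sconj rmorphXn /= sreal_rnorm.
Qed.

(** The completeness of the complex numbers is reduced to that of the real
    numbers by taking real and imaginary parts. *)
Lemma seq_complete_scalar : seq_complete (K^o).
Proof.
case: c => u hu.
  by apply: (@complete_seq_complete R RealScalars).
have cR (h : R[i] -> R) : (forall a b, h (a - b) = h a - h b) ->
    (forall a, `|h a| <= rnorm (a : (scalar_field R ComplexScalars)^o)) ->
    exists x : R, (fun n => h (u n)) @ \oo --> x.
  move=> hB hb; apply: (@complete_seq_complete R RealScalars R^o) => e e0.
  have [N hN] := hu _ e0; exists N => m n Nm Nn.
  by rewrite /rnorm /= -hB (le_lt_trans (hb _)) // hN.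
have [x ux] : exists x : R, (fun n => complex.Re (u n)) @ \oo --> x.
  apply: cR => [a b|a]; [exact: raddfB|exact: (sRe_le_norm (c := ComplexScalars))].
have [y uy] : exists y : R, (fun n => complex.Im (u n)) @ \oo --> y.
  apply: cR => [a b|[a b]]; first exact: raddfB.
  rewrite /rnorm /= -sqrtr_sqr ler_sqrt ?lerDr ?sqr_ge0 //.
  by rewrite addr_ge0 // sqr_ge0.
exists (x +i* y)%C; apply/cvg_rnormP.
have h : (fun n => `|x - complex.Re (u n)| + `|y - complex.Im (u n)|) @ \oo --> (0 : R).
  rewrite -[X in _ --> X](addr0 0); apply: cvgD.
    by rewrite -(normr0 R) -(subrr x); apply: cvg_norm; apply: cvgB => //; exact: cvg_cst.
  by rewrite -(normr0 R) -(subrr y); apply: cvg_norm; apply: cvgB => //; exact: cvg_cst.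
apply: (squeeze_cvgr _ (cvg_cst 0) h); apply: nearW => n; rewrite rnorm_ge0 /=.
case: (u n) => a b /=; rewrite /rnorm /=.
rewrite -[leRHS]ger0_norm ?addr_ge0 // -sqrtr_sqr ler_sqrt ?sqr_ge0 //.
rewrite -(real_normK (num_real (x - a))) -(real_normK (num_real (y - b))).
rewrite [leRHS]sqrrD -addrA lerD2l lerDr.
by rewrite mulrn_wge0 // mulr_ge0.
Qed.

Lemma integration_hilbert (H : hilbertSpace R c) : integration_space H.
Proof. by split; [exact: complete_seq_complete|exact: norming_hilbert]. Qed.

Lemma integration_scalar : integration_space (K^o).
Proof. by split; [exact: seq_complete_scalar|exact: norming_scalar]. Qed.

End IntegrationSpaces.

(** * Square integrable functions *)

Lemma ler_sqr_2sqrD (R : realDomainType) (x y z : R) : 0 <= x -> x <= y + z ->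
  x ^+ 2 <= 2 * y ^+ 2 + 2 * z ^+ 2.
Proof.
move=> x0 xyz; apply: (@le_trans _ _ ((y + z) ^+ 2)).
  by rewrite ler_pXn2r // nnegrE (le_trans x0).
by have := sqr_ge0 (y - z); nra.
Qed.

Section SquareIntegrable.
Context (R : realType) (c : scalar_kind) (disp : measure_display).
Local Notation K := (scalar_field R c).
Context (T : measurableType disp) (mu : {measure set T -> \bar R}).
Hypothesis mu_complete : measure_is_complete mu.
Context (D : set T).

Local Notation ext F := (zero_ext D F).
Local Notation L2 := (in_L2 mu D).

(** This elementary inequality takes the place of that of Cauchy and Schwarz:
    it yields a bound for L P that is not homogeneous, but can be rescaled. *)
Lemma rnorm_ext_scale (V : normedModType K) (a : T -> K^o) (F : T -> V) t :
  rnorm (ext (fun t => (a t : K) *: F t) t) <=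
  rnorm (ext a t) ^+ 2 + rnorm (ext F t) ^+ 2.
Proof.
have -> : ext (fun t => (a t : K) *: F t) t = (ext a t : K) *: ext F t.
  by rewrite /zero_ext; case: ifP; rewrite // scaler0.
rewrite rnormZ; have := rnorm_ge0 (ext a t); have := rnorm_ge0 (ext F t).
set x := rnorm (ext F t); set y := rnorm (_ : K^o); nra.
Qed.

Lemma in_L2_integrable (V : normedModType K) (F : T -> V) : L2 F ->
  mu.-integrable setT (fun t => (rnorm (ext F t) ^+ 2)%:E).
Proof.
move=> [mF F2]; have mr : measurable_fun setT (fun t => rnorm (ext F t)).
  exact: (measurable_strong mu_complete (@rnorm_continuous _ _ V) mF).
apply/integrableP; split.
  by apply/measurable_EFinP; exact: measurable_funX.
under eq_integral do rewrite gee0_abs ?lee_fin ?sqr_ge0 //.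
rewrite integral_zero_ext in F2.
rewrite (eq_integral (fun t => (ext (fun t => rnorm (F t) ^+ 2) t)%:E)) // => t _.
by rewrite (zero_ext_comp D F (h := fun v => rnorm v ^+ 2)) // rnorm0 expr0n.
Qed.

Lemma in_L2_intro (V : normedModType K) (F : T -> V) (g : T -> R) :
  strongly_measurable mu D F -> mu.-integrable setT (fun t => (g t)%:E) ->
  (forall t, rnorm (ext F t) ^+ 2 <= g t) -> L2 F.
Proof.
move=> mF ig Fg; split=> //.
have mr : measurable_fun setT (fun t => rnorm (ext F t)).
  exact: (measurable_strong mu_complete (@rnorm_continuous _ _ V) mF).
rewrite integral_zero_ext.
have /integrableP[_] := ig; apply: le_lt_trans.
rewrite (eq_integral (fun t => (rnorm (ext F t) ^+ 2)%:E)); last first.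
  move=> t _.
  by rewrite (zero_ext_comp D F (h := fun v => rnorm v ^+ 2)) // rnorm0 expr0n.
apply: ge0_le_integral => //.
- by move=> t _; rewrite lee_fin sqr_ge0.
- by apply/measurable_EFinP; exact: measurable_funX.
- by apply: measurableT_comp => //; exact: measurable_int ig.
- by move=> t _; rewrite lee_fin (le_trans (Fg t)) // ler_norm.
Qed.

Lemma in_L2_comb (V : normedModType K) (a : K) (F G : T -> V) :
  L2 F -> L2 G -> L2 (fun t => a *: F t + G t).
Proof.
move=> LF LG; have [[mF _] [mG _]] := (LF, LG).
have iF := in_L2_integrable LF; have iG := in_L2_integrable LG.
have iFG := integrableD measurableT
  (integrableZl measurableT (2 * rnorm (a : K^o) ^+ 2) iF)
  (integrableZl measurableT 2 iG).
apply: (in_L2_intro (g := fun t => 2 * rnorm (a : K^o) ^+ 2 * rnorm (ext F t) ^+ 2 +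
   2 * rnorm (ext G t) ^+ 2)) => //.
  apply: strongly_measurableD => //.
  apply: (strongly_measurable_map (g := fun v : V => a *: v)) mF.
    by move=> u v; rewrite scalerDr.
  exact: scaler_continuous.
move=> t; have -> : ext (fun t => a *: F t + G t) t = a *: ext F t + ext G t.
  by rewrite /zero_ext; case: ifP; rewrite // scaler0 addr0.
rewrite -mulrA -exprMn -rnormZ.
by apply: ler_sqr_2sqrD; [exact: rnorm_ge0|exact: ler_rnormD].
Qed.

Lemma bochner_conj (F : T -> K^o) : bochner_integrable mu D F ->
  bochner mu D (fun t => sconj (F t) : K^o) = sconj (bochner mu D F).
Proof.
move=> iF; have iK := integration_scalar R c.
have [||v|_ //] := bochner_map mu_complete (g := @sconj R c : K^o -> K^o)
  (C := 1) iK iK _ _ _ iF.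
- by move=> u v; exact: rmorphD.
- by move=> x v; rewrite [LHS]rmorphM /= sconj_sreal.
- by rewrite mul1r /rnorm normr_sconj.
Qed.

Lemma in_L2_conj (a : T -> K^o) : L2 a -> L2 (fun t => sconj (a t) : K^o).
Proof.
move=> La; have rconj (z : K^o) : rnorm (sconj z : K^o) = rnorm z.
  by rewrite /rnorm normr_sconj.
apply: (in_L2_intro _ (in_L2_integrable La)) => [|t].
  apply: (strongly_measurable_map (g := @sconj R c : K^o -> K^o)) La.1.
    by move=> u v; exact: rmorphD.
  apply: (bounded_additive_continuous (C := 1)) => [u v|v]; first exact: rmorphD.
  by rewrite mul1r rconj.
by rewrite /zero_ext; case: ifP; rewrite ?rconj.
Qed.

Lemma bochner_integrable_scale (V : normedModType K) (a : T -> K^o) (F : T -> V) :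
  L2 a -> L2 F -> bochner_integrable mu D (fun t => (a t : K) *: F t).
Proof.
move=> La LF; have [[ma _] [mF _]] := (La, LF).
have maF := strongly_measurable_scale ma mF; split=> //.
have iD := integrableD measurableT (in_L2_integrable La) (in_L2_integrable LF).
have /integrableP[_] := iD; apply: le_lt_trans.
rewrite integral_rnorm_ext; apply: ge0_le_integral => //.
- by move=> t _; rewrite lee_fin rnorm_ge0.
- apply/measurable_EFinP.
  exact: (measurable_strong mu_complete (@rnorm_continuous _ _ V) maF).
- by apply: measurableT_comp => //; exact: measurable_int iD.
- move=> t _; rewrite -EFinD lee_fin ger0_norm ?addr_ge0 ?sqr_ge0 //.
  exact: rnorm_ext_scale.
Qed.

Lemma integral_rnorm_scale (V : normedModType K) (a : T -> K^o) (F : T -> V) :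
  L2 a -> L2 F ->
  (\int[mu]_(t in D) (rnorm ((a t : K) *: F t))%:E <=
   \int[mu]_t (rnorm (ext a t) ^+ 2)%:E + \int[mu]_t (rnorm (ext F t) ^+ 2)%:E)%E.
Proof.
move=> La LF.
have iD := integrableD measurableT (in_L2_integrable La) (in_L2_integrable LF).
rewrite -integralD //; [|exact: in_L2_integrable|exact: in_L2_integrable].
rewrite integral_rnorm_ext; apply: le_integral => //.
  exact: bochner_integrable_rnorm (bochner_integrable_scale La LF).
by move=> t _; rewrite -EFinD lee_fin rnorm_ext_scale.
Qed.

End SquareIntegrable.

(** * The two data settings *)

Section LinearOperators.
Context (R : realType) (c : scalar_kind).
Local Notation K := (scalar_field R c).
Context (X Y : lmodType K) (L : partial_op X Y).
Hypothesis linL : linear_op L.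

Lemma linear_op0 : dom L 0 /\ ap L 0 = 0.
Proof.
have [d0 lin] := linL; split=> //.
have [_] := lin (-1) 0 0 d0 d0.
by rewrite scaler0 addr0 scaleN1r addNr.
Qed.

Lemma linear_opZ a x : dom L x -> dom L (a *: x) /\ ap L (a *: x) = a *: ap L x.
Proof.
move=> dx; have [d0 l0] := linear_op0.
by have := linL.2 a x 0 dx d0; rewrite l0 !addr0.
Qed.

Lemma linear_opD x y : dom L x -> dom L y ->
  dom L (x + y) /\ ap L (x + y) = ap L x + ap L y.
Proof. by move=> dx dy; have := linL.2 1 x y dx dy; rewrite !scale1r. Qed.

Lemma linear_opB x y : dom L x -> dom L y ->
  dom L (x - y) /\ ap L (x - y) = ap L x - ap L y.
Proof.
by move=> dx dy; have := linL.2 (-1) y x dy dx; rewrite !scaleN1r ![- _ + _]addrC.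
Qed.

Lemma linear_op_sum n (a : 'I_n -> K) (x : 'I_n -> X) : (forall i, dom L (x i)) ->
  dom L (\sum_(i < n) a i *: x i) /\
  ap L (\sum_(i < n) a i *: x i) = \sum_(i < n) a i *: ap L (x i).
Proof.
elim: n a x => [|n IH] a x dx; first by rewrite !big_ord0; exact: linear_op0.
rewrite !big_ord_recr /=.
have [|d1 e1] := IH (fun i => a (widen_ord (leqnSn n) i))
  (fun i => x (widen_ord (leqnSn n) i)); first by move=> i; exact: dx.
have [d2 e2] := linear_opZ (a ord_max) (dx ord_max).
by have [d3 ->] := linear_opD d1 d2; rewrite e1 e2.
Qed.

End LinearOperators.

Section PodStructure.
Context (R : realType) (c : scalar_kind).
Local Notation K := (scalar_field R c).

(** What the discrete and the continuous setting have in common. As S is only a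
    set of representatives, its linear structure is given by an operation comb,
    where comb a f g stands for a f + g. The last field says that L P is bounded
    on S: it is meant to be applied to large multiples of f. *)
Record pod_structure (X Y : hilbertSpace R c) (L : partial_op X Y)
    (S : data_space R c) (P : S -> X) (comb : K -> S -> S -> S) (M : R) : Prop :=
  PodStructure {
  pod_inhabited : exists g : S, ds_mem g ;
  pod_mem : forall a (f g : S), ds_mem f -> ds_mem g -> ds_mem (comb a f g) ;
  pod_dotl : forall a (f g h : S), ds_mem f -> ds_mem g -> ds_mem h ->
    ds_dot (comb a f g) h = a * ds_dot f h + ds_dot g h ;
  pod_dotC : forall f g : S, ds_mem f -> ds_mem g ->
    ds_dot g f = sconj (ds_dot f g) ;
  pod_dot_ge0 : forall f : S, ds_mem f -> 0 <= ds_dot f f ;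
  pod_lin : forall a (f g : S), ds_mem f -> ds_mem g ->
    P (comb a f g) = a *: P f + P g ;
  pod_dom : forall f : S, ds_mem f -> dom L (P f) ;
  pod_bound : forall f : S, ds_mem f ->
    rnorm (ap L (P f)) <= sRe (ds_dot f f) + M }.

Context (X Y : hilbertSpace R c) (L : partial_op X Y).
Hypothesis linL : linear_op L.

Lemma discrete_structure (s : nat) (gamma : 'I_s -> R) (w : 'I_s -> X) :
  (forall j, 0 < gamma j) -> (forall j, dom L (w j)) ->
  exists comb M, pod_structure L (S := discrete_space c gamma)
    (discrete_pod gamma w) comb M.
Proof.
move=> gamma0 dw.
exists (fun a f g => fun j => a * f j + g j), (\sum_(j < s) gamma j * rnorm (ap L (w j)) ^+ 2).
have dotE f : ds_dot (d := discrete_space c gamma) f f =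
    sreal c (\sum_(j < s) gamma j * rnorm (f j : K^o) ^+ 2).
  rewrite rmorph_sum; apply: eq_bigr => j _.
  by rewrite -mulrA mul_sconj rmorphM rmorphXn /= sreal_rnorm.
split=> //=.
- by exists (fun=> 0).
- move=> a f g h _ _ _; rewrite mulr_sumr -big_split; apply: eq_bigr => j _ /=.
  by rewrite mulrDr mulrDl !mulrA; congr (_ * _ * _ + _); rewrite mulrC.
- move=> f g _ _; rewrite rmorph_sum; apply: eq_bigr => j _.
  by rewrite !rmorphM /= sconjK sconj_sreal mulrAC.
- move=> f _; rewrite [leRHS]dotE -(rmorph0 (@sreal R c)) ler_sreal.
  by apply: sumr_ge0 => j _; rewrite mulr_ge0 ?sqr_ge0 // ltW.
- move=> a f g _ _; rewrite /discrete_pod scaler_sumr -big_split.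
  apply: eq_bigr => j _ /=.
  by rewrite mulrDr scalerDl scalerA; congr (_ *: _ + _); rewrite mulrCA.
- by move=> f _; exact: (linear_op_sum linL _ dw).1.
- move=> f _; rewrite (linear_op_sum linL _ dw).2.
  rewrite [X in sRe X]dotE srealK -big_split /=.
  apply: le_trans (ler_rnorm_sum _ _ _) _; apply: ler_sum => j _.
  rewrite -scalerA rnormZreal gtr0_norm // -mulrDr rnormZ.
  apply: ler_wpM2l; first exact: ltW.
  have := rnorm_ge0 (ap L (w j)); have := rnorm_ge0 (f j : K^o).
  set x := rnorm (ap L _); set y := rnorm _; nra.
Qed.

Section Continuous.
Context (d m : nat) (O : set 'rV[R]_d.+1).
Local Notation mu := (lebesgue_meas R d).
Local Notation ext F := (zero_ext (O : set (lebesgue_space R d)) F).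

(** The Lebesgue measure comes from the Caratheodory construction. *)
Lemma lebesgue_complete : measure_is_complete mu.
Proof. exact: measure_is_complete_caratheodory. Qed.

Implicit Types f g h : 'I_m -> lebesgue_space R d -> K.
Local Notation mem := (ds_mem (d := continuous_space c m O)).

Let dot f g (t : lebesgue_space R d) : K^o := \sum_(j < m) f j t * sconj (g j t).

Lemma continuous_integrable f g : mem f -> mem g ->
  bochner_integrable mu O (dot f g).
Proof.
move=> mf mg; apply: (bochner_integrable_sum lebesgue_complete) => j.
have mgc := in_L2_conj lebesgue_complete (mg j).
exact: (bochner_integrable_scale (V := K^o) lebesgue_complete (mf j) mgc).
Qed.

Lemma continuous_dotl (a : K) f g h : mem f -> mem g -> mem h ->
  bochner mu O (dot (fun j t => a * f j t + g j t) h) =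
  a * bochner mu O (dot f h) + bochner mu O (dot g h).
Proof.
move=> mf mg mh; have ifh := continuous_integrable mf mh.
have igh := continuous_integrable mg mh.
have [iaf eaf] := bochnerZ lebesgue_complete a (integration_scalar R c) ifh.
rewrite -[a * _]/(a *: (_ : K^o)) -eaf.
rewrite -(bochnerD lebesgue_complete (integration_scalar R c) iaf igh).
congr (bochner _ _ _); apply/funext => t.
rewrite -[a *: dot f h t]/(a * dot f h t) /dot mulr_sumr -big_split.
by apply: eq_bigr => j _; rewrite mulrDl mulrA.
Qed.

Lemma continuous_dotC f g : mem f -> mem g ->
  bochner mu O (dot g f) = sconj (bochner mu O (dot f g)).
Proof.
move=> mf mg.
rewrite -(bochner_conj lebesgue_complete (continuous_integrable mf mg)).
congr (bochner _ _ _); apply/funext => t; rewrite /dot rmorph_sum.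
by apply: eq_bigr => j _; rewrite rmorphM /= sconjK mulrC.
Qed.

Lemma continuous_dotxx f : mem f ->
  (sRe (bochner mu O (dot f f)))%:E =
  (\sum_(j < m) \int[mu]_t (rnorm (ext (f j : _ -> K^o) t) ^+ 2)%:E)%E.
Proof.
move=> mf; have [cK nK] := integration_scalar R c.
rewrite (bochner_functional lebesgue_complete cK nK (real_functional_sRe R c)
  (continuous_integrable mf mf)).
rewrite -integral_sum //; last first.
  by move=> j; exact: (in_L2_integrable (V := K^o) lebesgue_complete (mf j)).
apply: eq_integral => t _; rewrite sumEFin; congr EFin.
rewrite /zero_ext; case: ifP => _; last first.
  by rewrite raddf0 big1 // => j _; rewrite rnorm0 expr0n.
rewrite /dot raddf_sum; apply: eq_bigr => j _.
by rewrite /= mul_sconj -(sreal_rnorm (V := K^o)) -rmorphXn srealK.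
Qed.

Lemma continuous_dot_ge0 f : mem f -> 0 <= bochner mu O (dot f f).
Proof.
move=> mf; rewrite (sconj_fixed (esym (continuous_dotC mf mf))).
rewrite -(rmorph0 (@sreal R c)) ler_sreal -lee_fin continuous_dotxx //.
by apply: sume_ge0 => j _; apply: integral_ge0 => t _; rewrite lee_fin sqr_ge0.
Qed.

Section Pod.
Context (H : hilbertSpace R c) (w : 'I_m -> lebesgue_space R d -> H).
Hypothesis w2 : forall j, in_L2 mu O (w j).

Lemma continuous_pod_lin (a : K) f g : mem f -> mem g ->
  continuous_pod O w (fun j t => a * f j t + g j t) =
  a *: continuous_pod O w f + continuous_pod O w g.
Proof.
move=> mf mg; rewrite /continuous_pod scaler_sumr -big_split.
apply: eq_bigr => j _ /=.
have ifw := bochner_integrable_scale lebesgue_complete (mf j) (w2 j).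
have igw := bochner_integrable_scale lebesgue_complete (mg j) (w2 j).
have [iaf eaf] := bochnerZ lebesgue_complete a (integration_hilbert H) ifw.
rewrite -eaf -(bochnerD lebesgue_complete (integration_hilbert H) iaf igw).
by congr (bochner _ _ _); apply/funext => t; rewrite scalerDl scalerA.
Qed.

Lemma continuous_pod_bound : exists M : R, forall f, mem f ->
  rnorm (continuous_pod O w f) <= sRe (bochner mu O (dot f f)) + M.
Proof.
have wfin j : (\int[mu]_t (rnorm (ext (w j) t) ^+ 2)%:E)%E \is a fin_num.
  exact: integrable_fin_num (in_L2_integrable lebesgue_complete (w2 j)).
exists (\sum_(j < m) fine (\int[mu]_t (rnorm (ext (w j) t) ^+ 2)%:E)%E) => f mf.
rewrite -lee_fin EFinD continuous_dotxx // -sumEFin.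
rewrite (eq_bigr _ (fun j _ => fineK (wfin j))) -big_split /=.
apply: le_trans (_ : (\sum_(j < m) (rnorm (bochner mu O
   (fun t => f j t *: w j t)))%:E <= _)%E).
  by rewrite sumEFin lee_fin; exact: ler_rnorm_sum.
apply: lee_sum => j _.
have [cH nH] := integration_hilbert H.
have ifw := bochner_integrable_scale lebesgue_complete (mf j) (w2 j).
apply: le_trans (rnorm_bochner lebesgue_complete cH nH ifw) _.
exact: (integral_rnorm_scale lebesgue_complete (mf j) (w2 j)).
Qed.

End Pod.

Lemma continuous_structure (w : 'I_m -> lebesgue_space R d -> X) :
  (forall j, in_L2 mu O (w j)) ->
  (forall j, in_L2 mu O (fun t => ap L (w j t))) ->
  (forall f, mem f -> dom L (continuous_pod O w f) /\
     ap L (continuous_pod O w f) = continuous_pod O (fun j t => ap L (w j t)) f) ->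
  exists (comb : K -> _ -> _ -> _) M,
    pod_structure L (S := continuous_space c m O) (continuous_pod O w) comb M.
Proof.
move=> w2 Lw2 Lpod; have [M Mb] := continuous_pod_bound Lw2.
exists (fun a f g => fun j t => a * f j t + g j t), M; split.
- exists (fun _ _ => 0) => j; split; first exact: strongly_measurable0.
  under eq_integral do rewrite rnorm0 expr0n.
  by rewrite integral0_eq.
- by move=> a f g mf mg j; exact: (in_L2_comb lebesgue_complete a (mf j) (mg j)).
- exact: continuous_dotl.
- exact: continuous_dotC.
- exact: continuous_dot_ge0.
- exact: continuous_pod_lin.
- by move=> f /Lpod[].
- by move=> f mf; rewrite (Lpod f mf).2; exact: Mb.
Qed.

End Continuous.

Lemma pod_setting_structure (S : data_space R c) (P : S -> X) :
  pod_setting L P -> exists comb M, pod_structure L P comb M.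
Proof.
case=> [s gamma w _ gamma0 dw|d m O w _ _ w2 _ Lw2 Lpod].
  exact: discrete_structure.
exact: continuous_structure.
Qed.

End PodStructure.

(** * Subspaces *)

Section Spans.
Context (R : realType) (c : scalar_kind).
Local Notation K := (scalar_field R c).

(** If n < m, the m x n matrix of the coefficients of the v i has a nonzero left
    kernel, which gives a linear relation between the v i. *)
Lemma lin_indep_spanned (V : lmodType K) (m n : nat) (v : 'I_m -> V) (b : 'I_n -> V) :
  lin_indep v -> (forall i, spanned b (v i)) -> (m <= n)%N.
Proof.
move=> vfree vb; rewrite leqNgt; apply/negP => nm.
have [A vA] : exists A : 'M[K]_(m, n), forall i, v i = \sum_(j < n) A i j *: b j.
  have ch i : {a : 'I_n -> K | v i = \sum_(j < n) a j *: b j}.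
    by apply: cid; have [a ->] := vb i; exists a.
  exists (\matrix_(i, j) sval (ch i) j) => i; rewrite {1}(svalP (ch i)).
  by apply: eq_bigr => j _; rewrite mxE.
have : kermx A != 0.
  rewrite -mxrank_eq0 mxrank_ker subn_eq0 -ltnNge.
  exact: leq_ltn_trans (rank_leq_col A) nm.
move=> /rowV0Pn[u /sub_kermxP uA /negP]; apply; apply/eqP/rowP => i; rewrite mxE.
apply: (vfree (fun i => u 0 i)).
under eq_bigr do rewrite vA scaler_sumr.
rewrite exchange_big big1 // => j _ /=.
under eq_bigr do rewrite scalerA.
rewrite -scaler_suml; have := congr1 (fun B : 'rV_n => B 0 j) uA.
by rewrite !mxE => ->; rewrite scale0r.
Qed.

Lemma monotone_cauchy (u : nat -> R) : (forall n, 0 <= u n) ->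
  nonincreasing_seq u -> forall e : R, 0 < e ->
  exists N, forall m n, (N <= m)%N -> (N <= n)%N -> `|u m - u n| < e.
Proof.
move=> u0 du e e0.
have cu : cvgn u by apply: nonincreasing_is_cvgn => //; exists 0 => _ [n _ <-].
have e2 : 0 < e / 2 by rewrite divr_gt0.
have /cvgrPdist_lt/(_ _ e2)[N _ hN] := cu.
exists N => m n Nm Nn; have := hN m Nm; have := hN n Nn => /= hn hm.
rewrite -(subrKA (limn u)) (le_lt_trans (ler_normD _ _)) //.
by rewrite distrC [X in _ < X]splitr ltrD.
Qed.

Context (H : hilbertSpace R c).

Lemma orthonormal_lin_indep n (b : 'I_n -> H) :
  (forall i j, hdot H (b i) (b j) = (i == j)%:R) -> lin_indep b.
Proof.
move=> ob a ab0 i; have := congr1 (fun x => hdot H x (b i)) ab0.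
rewrite hdot0l hdot_suml (bigD1 i) //= big1 => [|j ji].
  by rewrite hdotZl ob eqxx mulr1 addr0.
by rewrite hdotZl ob (negPf ji) mulr0.
Qed.

Lemma hdot_spanned n (b : 'I_n -> H) x y : (forall i, hdot H x (b i) = 0) ->
  spanned b y -> hdot H x y = 0.
Proof.
move=> xb [a ->]; rewrite hdotC hdot_suml big1 ?rmorph0 // => i _.
by rewrite hdotZl hdotC xb rmorph0 mulr0.
Qed.

Lemma spannedB n (b : 'I_n -> H) x y :
  spanned b x -> spanned b y -> spanned b (x - y).
Proof.
move=> [a ->] [a' ->]; exists (fun i => a i - a' i); rewrite -sumrB.
by apply: eq_bigr => i _; rewrite scalerBl.
Qed.

Lemma orth_projE n (b : 'I_n -> H) x p : spanned b p ->
  (forall i, hdot H (x - p) (b i) = 0) -> orth_proj (spanned b) x = p.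
Proof.
move=> bp xp; rewrite /orth_proj.
have pP : [set p | spanned b p /\ forall v, spanned b v -> hdot H (x - p) v = 0] p.
  by split=> // v; exact: hdot_spanned.
have [bq xq] := xgetI 0 pP; set q := xget _ _ in bq xq *.
apply/eqP; rewrite -subr_eq0; apply/eqP/hdot_eq0.
have bqp := spannedB bq bp.
have {1}-> : q - p = (x - p) - (x - q) by rewrite opprB [RHS]addrC addrA subrK.
by rewrite hdotBl (hdot_spanned xp bqp) xq // subr0.
Qed.

Lemma orth_proj_id n (b : 'I_n -> H) x :
  spanned b x -> orth_proj (spanned b) x = x.
Proof. by move=> bx; apply: orth_projE => // i; rewrite subrr hdot0l. Qed.

(** One step of the Gram-Schmidt process: the component of b n orthogonal to
    the previous vectors is added, and a zero component is harmless because
    division by zero gives zero. *)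
Lemma span_projection (b : nat -> H) n y : exists a : nat -> K,
  forall i, (i < n)%N -> hdot H (y - \sum_(k < n) a k *: b k) (b i) = 0.
Proof.
elim: n y => [|n IH] y; first by exists (fun=> 0).
have [a ya] := IH y; have [d bd] := IH (b n).
pose p := \sum_(k < n) a k *: b k; pose q := \sum_(k < n) d k *: b k.
pose t := hdot H (y - p) (b n - q) / hdot H (b n - q) (b n - q).
exists (fun k => if k == n then t else a k - t * d k) => i.
have -> : \sum_(k < n.+1) (if k == n :> nat then t else a k - t * d k) *: b k =
    p + t *: (b n - q).
  rewrite big_ord_recr /= eqxx scalerBr addrCA addrC; congr (_ + _).
  rewrite /p /q scaler_sumr -sumrB; apply: eq_bigr => k _.
  by rewrite ltn_eqF ?ltn_ord // scalerBl scalerA.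
have old j : (j < n)%N -> hdot H (y - (p + t *: (b n - q))) (b j) = 0.
  by move=> jn; rewrite opprD addrA hdotBl ya // hdotZl bd // mulr0 subr0.
rewrite ltnS leq_eqVlt => /orP[/eqP ->|]; last exact: old.
rewrite -{2}(subrK q (b n)) hdotC hdotDl rmorphD /= -!hdotC.
have -> : hdot H (y - (p + t *: (b n - q))) q = 0.
  by apply: (hdot_spanned (b := fun k : 'I_n => b k)) => [k|]; [exact: old|exists d].
rewrite addr0 opprD addrA hdotBl hdotZl.
have [->|bq0] := eqVneq (b n - q) 0; first by rewrite !hdot0r mulr0 subr0.
rewrite divfK ?subrr //; apply: contra_neq bq0; exact: hdot_eq0.
Qed.

End Spans.

(** * The singular value expansion of L P *)

Section Expansion.
Context (R : realType) (c : scalar_kind).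
Local Notation K := (scalar_field R c).
Context (X Y : hilbertSpace R c) (L : partial_op X Y) (S : data_space R c).
Context (P : S -> X) (comb : K -> S -> S -> S) (M : R).
Hypotheses (linL : linear_op L) (pod : pod_structure L P comb M).
Context (sigma : nat -> R) (f : nat -> S) (phi : nat -> X).
Hypothesis svd : is_svd P sigma f phi.

Local Notation mem := (@ds_mem R c S).
Local Notation dot := (@ds_dot R c S).

Lemma sigma_ge0 k : 0 <= sigma k.
Proof. by case: svd => -[]. Qed.

Lemma sigma_gt0_leq j k : (j <= k)%N -> 0 < sigma k -> 0 < sigma j.
Proof. by move=> jk sk; case: svd => -[_ dec] _ _ _ _; exact: lt_le_trans (dec _ _ jk). Qed.

Lemma pod_zero : exists z : S,
  [/\ mem z, P z = 0, forall h, mem h -> dot z h = 0 & forall h, mem h -> dot h z = 0].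
Proof.
have [z mz] := pod_inhabited pod; pose z0 := comb (-1) z z.
have mz0 : mem z0 by exact: (pod_mem pod).
have z0l h : mem h -> dot z0 h = 0.
  by move=> mh; rewrite (pod_dotl pod) // mulN1r addNr.
exists z0; split=> //; first by rewrite (pod_lin pod) // scaleN1r addNr.
by move=> h mh; rewrite (pod_dotC pod mz0 mh) z0l // rmorph0.
Qed.

(** The bound on L P is not homogeneous; applied to large multiples of h, it
    yields continuity at 0. *)
Lemma pod_continuous (e : R) : 0 < e -> exists2 d : R, 0 < d &
  forall h, mem h -> sRe (dot h h) < d -> rnorm (ap L (P h)) < e.
Proof.
move=> e0; have M0 : 0 < `|M| + 1 by rewrite ltr_wpDl.
have [s s0 sE] : exists2 s : R, 0 < s & s * e = 2 * (`|M| + 1).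
  exists (2 * (`|M| + 1) / e); last by rewrite divfK // gt_eqF.
  by rewrite divr_gt0 // mulr_gt0.
exists (e / (2 * s)) => [|h mh]; first by rewrite divr_gt0 // mulr_gt0.
rewrite ltr_pdivlMr; last by rewrite mulr_gt0.
move=> he.
have [z [mz Pz z0 z0r]] := pod_zero.
pose g := comb (sreal c s) h z; have mg : mem g by exact: (pod_mem pod).
have dotg : sRe (dot g g) = s ^+ 2 * sRe (dot h h).
  rewrite (pod_dotl pod) // z0 // addr0 (pod_dotC pod mg mh) (pod_dotl pod) //.
  rewrite z0 // addr0 rmorphM /= sconj_sreal -(pod_dotC pod mh mh).
  by rewrite !sReM mulrA expr2.
have [_ Lg] := linear_opZ linL (sreal c s) (pod_dom pod mh).
have := pod_bound pod mg; rewrite dotg (pod_lin pod) // Pz addr0 Lg.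
rewrite rnormZreal gtr0_norm // => hb.
rewrite -(ltr_pM2l s0); apply: le_lt_trans hb _.
have MM : M <= `|M| by exact: ler_norm.
move: (sRe _) he => q he; have : s * (q * (2 * s)) < s * e by rewrite ltr_pM2l.
by rewrite sE expr2; nra.
Qed.

(** The expansion of P (f k) has a single term: a term with sigma j = 0 vanishes
    even though f j is then arbitrary. *)
Lemma pod_singular k : 0 < sigma k -> P (f k) = sreal c (sigma k) *: phi k.
Proof.
move=> sk; case: svd => _ memf orthf _ /(_ _ (memf k sk)).
have term j : (sreal c (sigma j) * dot (f k) (f j)) *: phi j =
    if j == k then sreal c (sigma k) *: phi k else 0.
  case: eqVneq => [->|jk]; first by rewrite orthf // eqxx mulr1.
  have [s0|s0] := eqVneq (sigma j) 0; first by rewrite s0 rmorph0 mul0r scale0r.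
  rewrite orthf // ?lt0r ?s0 ?sigma_ge0 //.
  by rewrite eq_sym (negPf jk) mulr0 scale0r.
move=> cvgP; apply: (cvg_unique _ cvgP) => //.
apply: cvg_near_cst; exists k.+1 => // n /= kn.
under eq_bigr do rewrite term.
rewrite -big_mkcond /=.
by rewrite (big_pred1 (Ordinal kn)) // => j; rewrite -val_eqE.
Qed.

Lemma dom_phi k : 0 < sigma k -> dom L (phi k).
Proof.
move=> sk; case: svd => _ memf _ _ _.
have := (linear_opZ linL (sreal c (sigma k)^-1) (pod_dom pod (memf k sk))).1.
rewrite pod_singular // scalerA -rmorphM mulVf ?gt_eqF //.
by rewrite rmorph1 scale1r.
Qed.

Definition coef (g : S) k : K := sreal c (sigma k) * dot g (f k).

Lemma coef0 g k : ~ 0 < sigma k -> coef g k = 0.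
Proof.
move=> s0; suff s00 : sigma k = 0 by rewrite /coef s00 rmorph0 mul0r.
by apply/eqP; rewrite eq_le sigma_ge0 andbT leNgt; exact/negP.
Qed.

Lemma svd_cvg g : mem g -> (fun n => \sum_(k < n) coef g k *: phi k) @ \oo --> P g.
Proof. by case: svd => _ _ _ _; apply. Qed.

(** The singular values decrease, so all coefficients from n on are zero. *)
Lemma coef_stable (V : lmodType K) (v : nat -> V) g n : ~ 0 < sigma n ->
  forall m, (n <= m)%N -> \sum_(k < m) coef g k *: v k = \sum_(k < n) coef g k *: v k.
Proof.
move=> sn; elim=> [|m IH]; first by rewrite leqn0 => /eqP ->.
rewrite leq_eqVlt => /orP[/eqP -> //|]; rewrite ltnS => nm.
rewrite big_ord_recr /= IH // coef0 ?scale0r ?addr0 //.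
by move=> sm; apply: sn; exact: sigma_gt0_leq nm sm.
Qed.

Lemma svd_finite g n : mem g -> ~ 0 < sigma n -> P g = \sum_(k < n) coef g k *: phi k.
Proof.
move=> mg sn; apply: (cvg_unique _ (svd_cvg mg)) => //.
by apply: cvg_near_cst; exists n => // m; exact: coef_stable.
Qed.

Lemma orth_phi n : (forall k, (k < n)%N -> 0 < sigma k) ->
  forall i j : 'I_n, hdot X (phi i) (phi j) = (i == j)%:R.
Proof.
by move=> sn i j; case: svd => _ _ _ orth _; rewrite orth ?sn // -val_eqE.
Qed.

Lemma hdot_pod g k : mem g -> 0 < sigma k -> hdot X (P g) (phi k) = coef g k.
Proof.
move=> mg sk; apply: (cvg_unique _ (hdot_cvg (y := phi k) (svd_cvg mg))) => //.
apply: cvg_near_cst; exists k.+1 => // n /= kn.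
rewrite hdot_suml (bigD1 (Ordinal kn)) //= big1 => [|j jk].
  by rewrite addr0 hdotZl; case: svd => _ _ _ -> // _; rewrite eqxx mulr1.
rewrite hdotZl; have [sj|sj] := pselect (0 < sigma j); last first.
  by rewrite coef0 // mul0r.
case: svd => _ _ _ -> // _.
by move: jk; rewrite -val_eqE /= => /negPf ->; rewrite mulr0.
Qed.

Lemma orth_proj_pod g n : mem g -> (forall k, (k < n)%N -> 0 < sigma k) ->
  orth_proj (spanned (fun k : 'I_n => phi k)) (P g) = \sum_(k < n) coef g k *: phi k.
Proof.
move=> mg sn; apply: orth_projE; first by exists (fun k : 'I_n => coef g k).
move=> i; rewrite hdotBl hdot_pod ?sn // hdot_suml (bigD1 i) //= big1 => [|j ji].
  by rewrite hdotZl (orth_phi sn) eqxx mulr1 addr0 subrr.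
by rewrite hdotZl (orth_phi sn) (negPf ji) mulr0.
Qed.

Lemma ap_sum (a : nat -> K) n : (forall k, a k = 0 \/ 0 < sigma k) ->
  dom L (\sum_(k < n) a k *: phi k) /\
  ap L (\sum_(k < n) a k *: phi k) = \sum_(k < n) a k *: ap L (phi k).
Proof.
move=> ha; elim: n => [|n [dn en]]; first by rewrite !big_ord0; exact: linear_op0.
rewrite !big_ord_recr /=; have [->|sn] := ha n; first by rewrite !scale0r !addr0.
have [d1 e1] := linear_opZ linL (a n) (dom_phi sn).
by have [d2 ->] := linear_opD linL dn d1; rewrite en e1.
Qed.

Lemma ap_coef g n : dom L (\sum_(k < n) coef g k *: phi k) /\
  ap L (\sum_(k < n) coef g k *: phi k) = \sum_(k < n) coef g k *: ap L (phi k).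
Proof.
apply: ap_sum => k; have [sk|sk] := pselect (0 < sigma k); first by right.
by left; exact: coef0.
Qed.

(** For a linear operator this is the closedness of the graph. *)
Definition closed_at0 := forall (u : nat -> X) (z : Y), (forall n, dom L (u n)) ->
  u @ \oo --> (0 : X) -> (fun n => ap L (u n)) @ \oo --> z -> z = 0.

Section Residuals.
Hypothesis sigma_gt0 : forall k, 0 < sigma k.
Context (g : S).
Hypothesis mg : mem g.

(** The difference of g and the sum of the <g, f k> f k for k < n, written with
    comb since S has no other linear structure. *)
Fixpoint residual n : S :=
  if n is m.+1 then comb (- dot g (f m)) (f m) (residual m) else g.

Let mf k : mem (f k).
Proof. by case: svd => _ memf _ _ _; exact: memf. Qed.

Let orthf j k : dot (f j) (f k) = (j == k)%:R.
Proof. by case: svd => _ _ orth _ _; exact: orth. Qed.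

Lemma residual_mem n : mem (residual n).
Proof. by elim: n => //= n IH; exact: (pod_mem pod). Qed.

Lemma residual_dot n k : dot (residual n) (f k) = if (k < n)%N then 0 else dot g (f k).
Proof.
elim: n => //= n IH; rewrite (pod_dotl pod) //; last exact: residual_mem.
rewrite orthf IH [in RHS]ltnS [in RHS]leq_eqVlt [n == k]eq_sym; case: eqVneq => [->|kn] /=.
  by rewrite ltnn mulr1 addNr.
by rewrite mulr0 add0r.
Qed.

Lemma residual_pod n : P (residual n) = P g - \sum_(k < n) coef g k *: phi k.
Proof.
elim: n => [|n IH]; first by rewrite big_ord0 subr0.
rewrite /= (pod_lin pod) //; last exact: residual_mem.
rewrite IH big_ord_recr /= pod_singular // scalerA mulNr scaleNr /coef.
by rewrite [dot g _ * sreal c _]mulrC opprD [RHS]addrA [RHS]addrC.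
Qed.

(** The difference of the two residuals is a combination of the f k with k < n,
    to which residual n is orthogonal. *)
Lemma residual_dot_later m n : (m <= n)%N ->
  dot (residual n) (residual m) = dot (residual n) (residual n).
Proof.
move=> mn; pose p := n; have pn : (n <= p)%N by [].
have mm := residual_mem; move: mn; rewrite -/p in pn *.
suff aux j : (j <= p)%N -> dot (residual p) (residual j) = dot (residual p) g.
  by move=> mn; rewrite !aux.
elim: j => //= j IH jp.
rewrite (pod_dotC pod) ?(pod_dotl pod) //; last first.
  by apply: (pod_mem pod).
rewrite rmorphD rmorphM /= -!(pod_dotC pod) // IH ?(ltnW jp) //.
by rewrite residual_dot jp mulr0 add0r.
Qed.

Let q n := sRe (dot (residual n) (residual n)).

(** Pythagoras; as the q n are nonnegative and decrease, they form a Cauchy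
    sequence, and so do the residuals. *)
Lemma residual_diff m n : (m <= n)%N ->
  sRe (dot (comb (-1) (residual n) (residual m)) (comb (-1) (residual n) (residual m)))
  = q m - q n.
Proof.
move=> mn; have mm := residual_mem.
have md : mem (comb (-1) (residual n) (residual m)) by exact: (pod_mem pod).
have rl k : mem k -> dot k (comb (-1) (residual n) (residual m)) =
    - dot k (residual n) + dot k (residual m).
  move=> mk; rewrite (pod_dotC pod md mk) (pod_dotl pod) // rmorphD rmorphM /=.
  by rewrite rmorphN rmorph1 mulN1r -!(pod_dotC pod).
rewrite (pod_dotl pod) // !rl // (residual_dot_later mn) addNr mulr0 add0r.
rewrite (pod_dotC pod (mm n) (mm m)) (residual_dot_later mn) -(pod_dotC pod) //.
by rewrite addrC raddfB.
Qed.

Lemma residual_cauchy (e : R) : 0 < e ->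
  exists N, forall m n, (N <= m)%N -> (N <= n)%N ->
    rnorm (ap L (P (residual m)) - ap L (P (residual n))) < e.
Proof.
move=> e0; have mm := residual_mem.
have q0 n : 0 <= q n.
  have := pod_dot_ge0 pod (mm n); rewrite -(rmorph0 (@sreal R c)) => h.
  by rewrite -(ler_sreal c) sReK // -(rmorph0 (@sreal R c)).
have mdiff m n : mem (comb (-1) (residual n) (residual m)) by exact: (pod_mem pod).
have dq : nonincreasing_seq q.
  move=> m n mn; rewrite -subr_ge0 -residual_diff //.
  have := pod_dot_ge0 pod (mdiff m n).
  by move=> h; rewrite -(ler_sreal c) sReK // rmorph0.
have [d d0 hd] := pod_continuous e0.
have [N hN] := monotone_cauchy q0 dq d0.
have aux m n : (N <= m)%N -> (m <= n)%N ->
    rnorm (ap L (P (residual m)) - ap L (P (residual n))) < e.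
  move=> Nm mn; have := hd _ (mdiff m n); rewrite residual_diff //.
  have := hN m n Nm (leq_trans Nm mn); move=> /ltr_normlW lt /(_ lt).
  rewrite (pod_lin pod) // scaleN1r addrC.
  by rewrite (linear_opB linL (pod_dom pod (mm m)) (pod_dom pod (mm n))).2.
exists N => m n Nm Nn; have [mn|/ltnW nm] := leqP m n; first exact: aux.
by rewrite rnormB; exact: aux.
Qed.

(** The residuals of g in S form a Cauchy sequence by Bessel's inequality, hence
    so do their images under the bounded operator L P. The images under P tend
    to zero, and L is closed. *)
Lemma pod_residual_cvg : closed_at0 ->
  (fun n => ap L (P (residual n))) @ \oo --> (0 : Y).
Proof.
move=> cL; have [z hz] := complete_seq_complete residual_cauchy.
suff z0 : z = 0 by move: hz; rewrite z0.
apply: (cL (fun n => P (residual n))) => //.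
  by move=> n; apply: (pod_dom pod); exact: residual_mem.
under eq_fun do rewrite residual_pod.
have : (fun n => P g - \sum_(k < n) coef g k *: phi k) @ \oo --> P g - P g.
  by apply: cvgB; [exact: cvg_cst|exact: svd_cvg mg].
by rewrite subrr.
Qed.

End Residuals.

(** The image of the n-th residual under L P is L P g minus the partial sum. In
    the case of finite rank the partial sums are eventually constant. *)
Lemma pod_image_cvg g : (forall k, 0 < sigma k) /\ closed_at0 \/
    (exists n, ~ 0 < sigma n) -> mem g ->
  (fun n => \sum_(k < n) coef g k *: ap L (phi k)) @ \oo --> ap L (P g).
Proof.
move=> [[sk cL]|[n sn]] mg; last first.
  rewrite (svd_finite mg sn) (ap_coef g n).2.
  apply: cvg_near_cst; exists n => // m.
  exact: (coef_stable (fun k => ap L (phi k)) g sn).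
have := pod_residual_cvg sk mg cL => /(cvgB (cvg_cst (ap L (P g)))).
rewrite subr0; apply: cvg_trans; apply: near_eq_cvg; apply: nearW => n /=.
rewrite -[LHS]/(ap L (P g) - ap L (P (residual g n))).
rewrite residual_pod // (linear_opB linL (pod_dom pod mg) (ap_coef g n).1).2.
by rewrite (ap_coef g n).2 opprB addrC subrK.
Qed.

Lemma range_phi k : 0 < sigma k -> (P @` mem) (phi k).
Proof.
move=> sk; have [z [mz Pz _ _]] := pod_zero.
have mf : mem (f k) by case: svd => _ h _ _ _; exact: h.
exists (comb (sreal c (sigma k)^-1) (f k) z); first exact: (pod_mem pod).
rewrite (pod_lin pod) // Pz addr0 pod_singular // scalerA -rmorphM mulVf ?gt_eqF //.
by rewrite rmorph1 scale1r.
Qed.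

Lemma range_spanned n : (forall k, (k < n)%N -> 0 < sigma k) -> ~ 0 < sigma n ->
  P @` mem = spanned (fun k : 'I_n => phi k).
Proof.
move=> sk sn; apply/seteqP; split=> [_ [g mg <-]|_ [a ->]].
  by rewrite (svd_finite mg sn); exists (fun k : 'I_n => coef g k).
have {sn sk} : forall k : 'I_n, (P @` mem) (phi k) by move=> k; exact/range_phi/sk.
elim: n a => [|n IH] a hphi.
  by rewrite big_ord0; have [z [mz Pz _ _]] := pod_zero; exists z.
rewrite big_ord_recr /=.
have [g mg <-] := IH (fun k => a (widen_ord (leqnSn n) k))
  (fun k => hphi (widen_ord (leqnSn n) k)).
have [h mh <-] := hphi ord_max.
exists (comb (a ord_max) h g); first exact: (pod_mem pod).
by rewrite (pod_lin pod) // addrC.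
Qed.

(** Otherwise the singular vectors before the first zero singular value would be
    a finite basis of the range. *)
Lemma rank_none : is_dim (P @` mem) None -> forall k, 0 < sigma k.
Proof.
move=> inf k; apply: contrapT => sk.
have ex : exists n, ~~ (0 < sigma n) by exists k; exact/negP.
have [n /negP sn nmin] := ex_minnP ex.
have sj j : (j < n)%N -> 0 < sigma j.
  by move=> jn; apply: contraTT jn => /nmin; rewrite -leqNgt.
apply: (inf n); exists (fun k : 'I_n => phi k); split; last exact: range_spanned.
exact: orthonormal_lin_indep (orth_phi sj).
Qed.

(** The basis b of the range has n elements. It lies in the span of the phi j
    with j < k if sigma k = 0, and it spans the orthonormal vectors
    phi 0, ..., phi n if sigma n is positive; comparison of the dimensions
    excludes k < n in the first case and excludes the second one. *)
Lemma rank_some n : is_dim (P @` mem) (Some n) ->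
  (forall k, (k < n)%N -> 0 < sigma k) /\ ~ 0 < sigma n.
Proof.
move=> [b [bfree bE]]; split=> [k kn|sn].
  apply: contrapT => sk.
  have : (n <= k)%N.
    apply: (lin_indep_spanned (b := fun j : 'I_k => phi j) bfree) => i.
    have : spanned b (b i).
      exists (fun j => (j == i)%:R); rewrite (bigD1 i) //= eqxx scale1r.
      by rewrite big1 ?addr0 // => j /negPf ->; rewrite scale0r.
    rewrite -bE => -[g mg <-]; rewrite (svd_finite mg sk).
    by exists (fun j : 'I_k => coef g j).
  by rewrite leqNgt kn.
have sj j : (j < n.+1)%N -> 0 < sigma j by rewrite ltnS => jn; exact: sigma_gt0_leq jn sn.
have : (n.+1 <= n)%N.
  apply: (lin_indep_spanned (b := b) (orthonormal_lin_indep (orth_phi sj))) => i.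
  by rewrite -bE; apply: range_phi; exact: sj.
by rewrite ltnn.
Qed.

(** * The projected operators *)

Hypothesis injL : injective_op L.

Lemma pop_inv_ap x : dom L x -> ap (pop_inv L) (ap L x) = x.
Proof.
move=> dx; have /= [dx' Lx'] := xgetI point (P := [set x' | dom L x' /\ ap L x' = ap L x])
  (conj dx erefl).
exact: injL dx' dx Lx'.
Qed.

Lemma proj_op_ap n x p : dom L x -> dom L p ->
  orth_proj (spanned (fun k : 'I_n => phi k)) x = p ->
  dom (proj_op L phi n) (ap L x) /\ ap (proj_op L phi n) (ap L x) = ap L p.
Proof.
move=> dx dp xp; rewrite /proj_op /pop_comp /= -[xget _ _]/(ap (pop_inv L) (ap L x)).
rewrite pop_inv_ap // xp; split=> //; split=> //; split=> //.
by exists x.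
Qed.

Lemma proj_op_pod g n : mem g -> (forall k, (k < n)%N -> 0 < sigma k) ->
  ap (proj_op L phi n) (ap L (P g)) = \sum_(k < n) coef g k *: ap L (phi k).
Proof.
move=> mg sn; rewrite -(ap_coef g n).2.
exact: (proj_op_ap (pod_dom pod mg) (ap_coef g n).1 (orth_proj_pod mg sn)).2.
Qed.

(** A combination of the L phi k with k < n is L x for some x in the range of
    the projection. *)
Lemma proj_op_span (a : nat -> K) n r : (n <= r)%N ->
  (forall k, (k < n)%N -> 0 < sigma k) ->
  let y := \sum_(k < n) a k *: ap L (phi k) in
  dom (proj_op L phi r) y /\ ap (proj_op L phi r) y = y.
Proof.
move=> nr sn y; pose d k := if (k < n)%N then a k else 0.
have da k : d k = 0 \/ 0 < sigma k.
  by rewrite /d; case: ifP => [kn|_]; [right; exact: sn|left].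
have [dx Lx] := ap_sum n da.
have -> : y = ap L (\sum_(k < n) d k *: phi k).
  by rewrite Lx; apply: eq_bigr => k _; rewrite /d ltn_ord.
apply: (proj_op_ap dx dx); apply: orth_proj_id.
exists (fun k : 'I_r => d k).
rewrite (big_ord_widen r (fun k => d k *: phi k)) // big_mkcond /=.
by apply: eq_bigr => k _; rewrite /d; case: (k < n)%N; rewrite ?scale0r.
Qed.

(** If L^-1 is bounded and L (u n) tends to z, then z = L x and u n tends to
    L^-1 z = x, so x = 0. *)
Lemma closed_bounded : bounded_op L \/ bounded_op (pop_inv L) -> closed_at0.
Proof.
move=> [[_ [C LC]]|[domL [C LC]]] u z du u0 Luz.
  have Lu0 : (fun n => ap L (u n)) @ \oo --> (0 : Y).
    apply/cvg_rnormP; have /cvg_rnormP := u0.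
    under eq_fun do rewrite sub0r rnormN.
    move=> h; have {}h : (fun n => C * rnorm (u n)) @ \oo --> (0 : R).
      by rewrite -(mulr0 C); apply: cvgM => //; exact: cvg_cst.
    apply: (squeeze_cvgr _ (cvg_cst 0) h); apply: nearW => n.
    by rewrite sub0r rnormN rnorm_ge0 LC.
  exact: cvg_unique Luz Lu0.
have [x dx Lx] : dom (pop_inv L) z by rewrite domL.
have ux : u @ \oo --> x.
  apply/cvg_rnormP; have /cvg_rnormP := Luz.
  move=> h; have {}h : (fun n => C * rnorm (z - ap L (u n))) @ \oo --> (0 : R).
    by rewrite -(mulr0 C); apply: cvgM => //; exact: cvg_cst.
  apply: (squeeze_cvgr _ (cvg_cst 0) h); apply: nearW => n.
  rewrite rnorm_ge0 /=; have [dd e] := linear_opB linL dx (du n).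
  by rewrite -{1}(pop_inv_ap dd) e Lx LC.
have x0 : x = 0 by apply: cvg_unique ux u0.
by rewrite -Lx x0 (linear_op0 linL).2.
Qed.

Section Rank.
Context (sX : option nat).
Hypothesis rank : is_dim (P @` mem) sX.
Hypothesis bnd : sX <> None \/ bounded_op L \/ bounded_op (pop_inv L).

Lemma rank_cases : (forall k, 0 < sigma k) /\ closed_at0 \/ (exists n, ~ 0 < sigma n).
Proof.
case: sX rank bnd => [n|] rk bd; first by right; exists n; exact: (rank_some rk).2.
left; split; first exact: rank_none.
by apply: closed_bounded; case: bd.
Qed.

Let image_cvg g (mg : mem g) := pod_image_cvg rank_cases mg.

(** The tail of the series is bounded by the triangle inequality, for finite
    sums first and up to an arbitrary e. *)
Lemma projection_error g r : mem g -> (0 < r)%N -> 0 < sigma r.-1 ->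
  ((rnorm (ap L (P g) - ap (proj_op L phi r) (ap L (P g))))%:E <=
   \sum_(r <= k <oo) (sigma k * rnorm (dot g (f k) : K^o) * rnorm (ap L (phi k)))%:E)%E.
Proof.
move=> mg r0 sr; rewrite proj_op_pod //; last first.
  by move=> k kr; apply: sigma_gt0_leq sr; rewrite -ltnS prednK.
apply/lee_addgt0Pr => e e0.
have /cvg_rnormP/cvgrPdist_lt/(_ _ e0)[N _ hN] := image_cvg mg.
pose n := maxn N r; have := hN n (leq_maxl _ _).
rewrite /= sub0r normrN ger0_norm ?rnorm_ge0 // => lt_e.
pose term k := sigma k * rnorm (dot g (f k) : K^o) * rnorm (ap L (phi k)).
have term_ge0 k : (0 <= (term k)%:E)%E.
  by rewrite lee_fin !mulr_ge0 ?rnorm_ge0 // sigma_ge0.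
apply: (@le_trans _ _ (\sum_(r <= k < n) (term k)%:E + e%:E)%E); last first.
  by rewrite leeD2r //; apply: nneseries_lim_ge => k _ _; exact: term_ge0.
rewrite sumEFin -EFinD lee_fin.
pose s m := \sum_(k < m) coef g k *: ap L (phi k).
have sdiff : s n - s r = \sum_(r <= k < n) coef g k *: ap L (phi k).
  rewrite /s -!(big_mkord xpredT (fun k => coef g k *: ap L (phi k))).
  by rewrite (big_cat_nat (leq0n r) (leq_maxr N r)) /= addrAC subrr add0r.
have := ler_rnormD (ap L (P g) - s n) (s n - s r); rewrite subrKA sdiff => h.
apply: le_trans h _; rewrite addrC; apply: lerD; last exact: ltW.
apply: le_trans (ler_rnorm_sum _ _ _) _; apply: ler_sum => k _.
rewrite rnormZ; apply: ler_wpM2r; first exact: rnorm_ge0.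
rewrite /coef -[_ * dot g (f k)]/(sreal c (sigma k) *: (dot g (f k) : K^o)).
by rewrite rnormZreal ger0_norm // sigma_ge0.
Qed.

Lemma projection_cvg g : mem g -> cvg_upto sX
  (fun r => rnorm (ap L (P g) - ap (proj_op L phi r) (ap L (P g)))) 0.
Proof.
move=> mg; case E : sX rank => [n|] rk; rewrite /cvg_upto.
  have [sn snn] := rank_some rk; rewrite proj_op_pod // (svd_finite mg snn).
  by rewrite (ap_coef g n).2 subrr rnorm0.
have sk := rank_none rk.
have /cvg_rnormP := image_cvg mg; apply: cvg_trans; apply: near_eq_cvg.
by apply: nearW => n; rewrite proj_op_pod.
Qed.

Hypothesis eigen : forall lambda : K,
  eigenvalue_AAadj (fun g : S => ap L (P g)) lambda -> lambda != 0.

(** A vector orthogonal to the range of L P is in the kernel of the adjoint,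
    hence it is zero or an eigenvector for the eigenvalue 0. *)
Lemma range_total v : (forall g, mem g -> hdot Y (ap L (P g)) v = 0) -> v = 0.
Proof.
move=> hv; apply: contrapT => /eqP v0; have [z [mz Pz _ z0]] := pod_zero.
suff : (0 : K) != 0 by rewrite eqxx.
apply: eigen; exists v, z; split=> //.
  by move=> h mh; rewrite hv // z0.
by rewrite Pz (linear_op0 linL).2 scale0r.
Qed.

Lemma phi_total v : (forall k, 0 < sigma k -> hdot Y (ap L (phi k)) v = 0) -> v = 0.
Proof.
move=> hv; apply: range_total => g mg.
apply: (cvg_unique _ (hdot_cvg (y := v) (image_cvg mg))) => //.
apply: cvg_near_cst; apply: nearW => n.
rewrite hdot_suml big1 // => k _; rewrite hdotZl.
have [sk|sk] := pselect (0 < sigma k); first by rewrite hv // mulr0.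
by rewrite coef0 // mul0r.
Qed.

Lemma projection_finite n : sX = Some n -> forall y : Y,
  dom (proj_op L phi n) y /\ ap (proj_op L phi n) y = y.
Proof.
move=> E y; move: rank; rewrite E => rk; have [sn snn] := rank_some rk.
have [a ya] := span_projection (fun k => ap L (phi k)) n y.
suff -> : y = \sum_(k < n) a k *: ap L (phi k) by exact: proj_op_span.
apply/eqP; rewrite -subr_eq0; apply/eqP/phi_total => k sk.
rewrite hdotC ya ?rmorph0 // ltnNge; apply/negP => nk.
exact: snn (sigma_gt0_leq nk sk).
Qed.

(** The orthogonal projections of y onto the spans of the L phi k are a Cauchy
    sequence by Pythagoras; the difference of y and their limit is orthogonal
    to all L phi k. *)
Lemma span_approximation y (e : R) : (forall k, 0 < sigma k) -> 0 < e ->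
  exists (N : nat) (a : nat -> K), rnorm (y - \sum_(k < N) a k *: ap L (phi k)) < e.
Proof.
move=> sk e0; pose b k := ap L (phi k).
have ch n : {a : nat -> K | forall i, (i < n)%N ->
    hdot Y (y - \sum_(k < n) a k *: b k) (b i) = 0}.
  by apply: cid; exact: span_projection.
pose p n := \sum_(k < n) sval (ch n) k *: b k.
have yp n i : (i < n)%N -> hdot Y (y - p n) (b i) = 0 by exact: (svalP (ch n)).
have pyth m n : (n <= m)%N ->
    rnorm (y - p n) ^+ 2 = rnorm (y - p m) ^+ 2 + rnorm (p m - p n) ^+ 2.
  move=> nm; rewrite -rnormD_orthogonal ?subrKA // hdotBr.
  have ort j : (j <= m)%N -> hdot Y (y - p m) (p j) = 0.
    move=> jm; apply: (hdot_spanned (b := fun i : 'I_j => b i)).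
      by move=> i; apply: yp; exact: leq_trans (ltn_ord i) jm.
    by exists (fun k : 'I_j => sval (ch j) k).
  by rewrite !ort // subr0.
have dec : nonincreasing_seq (fun n => rnorm (y - p n) ^+ 2).
  by move=> n m nm; rewrite (pyth _ _ nm) lerDl sqr_ge0.
have [q pq] : exists q : Y, p @ \oo --> q.
  apply: complete_seq_complete => d d0.
  have [N hN] := monotone_cauchy (fun n => sqr_ge0 _) dec (exprn_gt0 2 d0).
  have aux m n : (N <= n)%N -> (n <= m)%N -> rnorm (p m - p n) < d.
    move=> Nn nm; have := hN n m Nn (leq_trans Nn nm).
    rewrite (pyth _ _ nm) addrAC subrr add0r => /ltr_normlW.
    by rewrite ltr_pXn2r ?nnegrE ?rnorm_ge0 // ltW.
  exists N => m n Nm Nn; have [nm|/ltnW mn] := leqP n m; first exact: aux.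
  by rewrite rnormB; exact: aux.
have yq : y = q.
  apply/eqP; rewrite -subr_eq0; apply/eqP/phi_total => k _.
  rewrite hdotC; suff -> : hdot Y (y - q) (b k) = 0 by rewrite rmorph0.
  have yq : (fun n => y - p n) @ \oo --> y - q.
    by apply: cvgB pq; exact: cvg_cst.
  apply: (cvg_unique _ (hdot_cvg (y := b k) yq)) => //.
  by apply: cvg_near_cst; exists k.+1 => // n; exact: yp.
rewrite -yq in pq; have /cvg_rnormP/cvgrPdist_lt/(_ _ e0)[N _ hN] := pq.
exists N, (sval (ch N)); have := hN N (leqnn N).
by rewrite /= sub0r normrN ger0_norm ?rnorm_ge0.
Qed.

(** The uniform bound reduces the claim to y in the span of the L phi k, where
    T r y = y as soon as r is large enough. *)
Lemma projection_total (T : nat -> {linear Y -> Y}) (C : R) : sX = None ->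
  (forall r, (0 < r)%N -> extends_op (T r) (proj_op L phi r) /\
     forall y, rnorm (T r y) <= C * rnorm y) ->
  forall y : Y, (fun r => T r y) @ \oo --> y.
Proof.
move=> E hT y; move: rank; rewrite E => rk; have sk := rank_none rk.
apply/cvg_rnormP/cvgrPdist_lt => e e0.
have C0 : 0 < `|C| + 1 by rewrite ltr_wpDl.
have ec : 0 < e / (`|C| + 1) by rewrite divr_gt0.
have [N [a]] := span_approximation y sk ec; set p := \sum_(k < N) _ => yp.
exists (maxn N 1) => // r /=; rewrite geq_max => /andP[Nr r0].
have [Text Tb] := hT r r0.
have [dp ep] := proj_op_span a Nr (fun k _ => sk k).
have Tp : T r p = p by rewrite Text.
rewrite sub0r normrN ger0_norm ?rnorm_ge0 //.
have -> : y - T r y = (y - p) - T r (y - p).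
  by rewrite linearB /= Tp opprB addrC addrA subrK addrC.
apply: le_lt_trans (ler_rnormD _ _) _; rewrite rnormN.
move: yp; rewrite ltr_pdivlMr // => yp; apply: le_lt_trans yp.
rewrite mulrDr mulr1 addrC lerD2r mulrC (le_trans (Tb _)) //.
by rewrite ler_wpM2r ?rnorm_ge0 // ler_norm.
Qed.

End Rank.

End Expansion.

Theorem theorem6p6 (R : realType) (c : scalar_kind) (X Y : hilbertSpace R c)
    (L : partial_op X Y) (S : data_space R c) (P : S -> X)
    (sigma : nat -> R) (f : nat -> S) (phi : nat -> X) (sX : option nat) :
  linear_op L -> injective_op L ->
  pod_setting L P ->
  is_svd P sigma f phi ->
  is_dim (P @` (@ds_mem R c S)) sX ->
  sX <> None \/ bounded_op L \/ bounded_op (pop_inv L) ->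
  let KY := fun g : S => ap L (P g) in
  (forall (g : S) (y : Y), ds_mem g -> y = KY g ->
     (forall r, (0 < r)%N -> 0 < sigma r.-1 ->
        ((rnorm (y - ap (proj_op L phi r) y))%:E <=
         \sum_(r <= k <oo)
           (sigma k * rnorm (ds_dot g (f k) : (scalar_field R c)^o) *
            rnorm (ap L (phi k)))%:E)%E) /\
     cvg_upto sX (fun r => rnorm (y - ap (proj_op L phi r) y)) 0) /\
  ((forall lambda, eigenvalue_AAadj KY lambda -> lambda != 0) ->
   (forall n, sX = Some n -> forall y : Y,
      dom (proj_op L phi n) y /\ ap (proj_op L phi n) y = y) /\
   (sX = None -> forall (T : nat -> {linear Y -> Y}) (C : R),
      (forall r, (0 < r)%N ->
         extends_op (T r) (proj_op L phi r) /\
         forall y, rnorm (T r y) <= C * rnorm y) ->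
      forall y : Y, (fun r => T r y) @ \oo --> y)).
Proof.
move=> linL injL /(pod_setting_structure linL)[comb [M pod]] svd rank bnd KY.
split=> [g y mg ->|eigen].
  split=> [r r0 sr|].
    exact: (projection_error linL pod svd injL rank bnd mg r0 sr).
  exact: (projection_cvg linL pod svd injL rank bnd mg).
split=> [n E y|E T C hT y].
  exact: (projection_finite linL pod svd injL rank bnd eigen E y).
exact: (projection_total linL pod svd injL rank bnd eigen E hT).
Qed.
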